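(* Let $k$ be a field. $\mathtt{ContFlow}_k$ is a dagger-category in only one of the two ways ($\dagger$ and $*$) that $\mathtt{SigFlow}_{k,s}$ is, namely via $*$ and not via $\dagger$. Specifically, the $*$-dual $f^*$ of a morphism $f$ in $\mathtt{ContFlow}_k$ is again a morphism in $\mathtt{ContFlow}_k$, such that $$A(f^* )=A(f)^*,\qquad B(f^* )=C(f)^*,\qquad D(f^* )=D(f)^*,\qquad C(f^* )=B(f)^*.$$
   Context: A dagger-category is a category with a contravariant, identity-on-objects functor to itself that is its own inverse (a dagger structure). A PROP is a strict symmetric monoidal category whose objects are the natural numbers, with monoidal product of objects given by addition. $\mathtt{FinRel}_k$ is the PROP whose morphisms $m\to n$ are linear relations $k^m\nrightarrow k^n$ (linear subspaces of $k^m\oplus k^n$), with composition of relations and direct sum. $\mathtt{SigFlow}_{k,s}$ is the free PROP on the generators $\mu\colon2\to1$ (addition), $\zeta\colon0\to1$ (zero), $\Delta\colon1\to2$ (duplication), $!\colon1\to0$ (deletion), $\cup\colon2\to0$, $\cap\colon0\to2$, $s_c\colon1\to1$ for each $c\in k$ (scaling), and $\int\colon1\to1$ (integrator). Its morphisms are string diagrams in these generators (signal-flow diagrams), modulo only the axioms of symmetric monoidal categories. Black-boxing an integrator-free diagram means interpreting it in $\mathtt{FinRel}_k$ via $\mu=\{(x,y,x+y)\}$, $\zeta=\{(0,0)\}$, $\Delta=\{(x,x,x)\}$, $!=\{(x,0)\}$, $\cup=\{(x,x,0)\}\subseteq k^2\oplus\{0\}$, $\cap=\{(0,x,x)\}\subseteq\{0\}\oplus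 k^2$, $s_c=\{(x,cx)\}$. Let $f\colon m\to p$ be a morphism in $\mathtt{SigFlow}_{k,s}$ with $n$ integrators (numbered $1,\dots,n$; the integrators of $f^*$ are numbered as the corresponding ones of $f$). Powers denote tensor powers. - $A(f)\colon k^n\nrightarrow k^n$: in $!^p\circ f\circ\zeta^m$, remove the integrators, replace the $n$ wires leaving the integrators by inputs and the $n$ wires entering them by outputs, then black-box. - $B(f)\colon k^m\nrightarrow k^n$: in $!^p\circ f$, remove the integrators, replace the $n$ wires entering the integrators by outputs, replace the $n$ wires leaving them by $\zeta^n$, then black-box. - $C(f)\colon k^n\nrightarrow k^p$: in $f\circ\zeta^m$, remove the integrators, replace the $n$ wires leaving the integrators by inputs, replace the $n$ wires entering them by $!^n$, then black-box. - $D(f)\colon k^m\nrightarrow k^p$: replace each integrator by $s_0$, then black-box. $\mathtt{ContFlow}_k$ is the subPROP of $\mathtt{SigFlow}_{k,s}$ consisting of those morphisms $f$ for which the linear relations $A(f),B(f),C(f),D(f)$ are all linear maps. $\mathtt{SigFlow}_{k,s}$ is taken to have two different dagger structures, $\dagger$ and $*$, each contravariant, identity on objects, and compatible with the monoidal product and symmetry. The duality $*$ turns diagrams around and swaps colors: $\mu^*=\Delta$, $\Delta^*=\mu$, $\zeta^*={!}$, $!^*=\zeta$, $s_c^*=s_c$, $\int^*=\int$, $\cap^*=\cup\circ(1\oplus s_{-1})$, $\cup^*=(1\oplus s_{-1})\circ\cap$. The duality $\dagger$ turns diagrams around using caps and cups: $\cap^\dagger=\cup$, $\cup^\dagger=\cap$,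 $g^\dagger=(\cup\oplus1)\circ(1\oplus g\oplus1)\circ(1\oplus\cap)$ for $g=s_c$ or $g=\int$, $\zeta^\dagger=\cup\circ(\zeta\oplus1)$, $!^\dagger=(!\oplus1)\circ\cap$, $\mu^\dagger=(1\oplus1\oplus\cup)\circ(1\oplus1\oplus\mu\oplus1)\circ(((1\oplus\cap\oplus1)\circ\cap)\oplus1)$, $\Delta^\dagger=((\cup\circ(1\oplus\cup\oplus1))\oplus1)\circ(1\oplus1\oplus\Delta\oplus1)\circ(1\oplus1\oplus\cap)$. The same rules (omitting $\int$) define $*$ on $\mathtt{FinRel}_k$; on linear maps, as on the right-hand sides above, $*$ is transposition.
   Formalization: In the free PROP neither * nor † is its own inverse (cap** contains two extra scalings by -1), so ''its own inverse'' is required only up to equality of black boxes with the integrators removed and all loose ends kept; the other dagger laws hold in the free PROP. *)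

(* Defs.v *)
From mathcomp Require Import all_boot all_order all_algebra.

Set Implicit Arguments.
Unset Strict Implicit.
Unset Printing Implicit Defensive.

Import GRing.Theory.
Local Open Scope ring_scope.

(* Linear relations k^m -|-> k^n, as predicates on pairs of column vectors.
   Linearity is not recorded: it holds for every black box, being preserved by
   composition and direct sum. *)
Definition rel_vec (k : fieldType) (m n : nat) : Type :=
  'cV[k]_m -> 'cV[k]_n -> Prop.

Definition eq_rel (k : fieldType) (m n : nat) (R S : rel_vec k m n) : Prop :=
  forall x y, R x y <-> S x y.

Definition graph (k : fieldType) (m n : nat) (M : 'M[k]_(n, m)) :
    rel_vec k m n :=
  fun x y => y = M *m x.

Definition is_linear_map (k : fieldType) (m n : nat) (R : rel_vec k m n) :
    Prop :=
  exists M : 'M[k]_(n, m), eq_rel R (graph M).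

(* R^* for a relation R that is a linear map, i.e. its transpose; no meaning
   is attached to the value on other relations. *)
Definition transpose_rel (k : fieldType) (m n : nat) (R : rel_vec k m n) :
    rel_vec k n m :=
  fun y x => exists M : 'M[k]_(n, m), eq_rel R (graph M) /\ graph M^T y x.

(* Integrators carry a label in L.  A signal-flow diagram has L = unit; a
   numbering of its integrators is a lift to L = 'I_n (see [numbering]). *)
Inductive gen (k : fieldType) (L : Type) : nat -> nat -> Type :=
| Add : gen k L 2 1
| Zero : gen k L 0 1
| Dup : gen k L 1 2
| Del : gen k L 1 0
| Cup : gen k L 2 0
| Cap : gen k L 0 2
| Scal of k : gen k L 1 1
| Int of L : gen k L 1 1.

Arguments Add {k L}.
Arguments Zero {k L}.
Arguments Dup {k L}.
Arguments Del {k L}.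
Arguments Cup {k L}.
Arguments Cap {k L}.
Arguments Scal {k L} _.
Arguments Int {k L} _.

(* Terms for the morphisms of the free PROP; its morphisms are the classes of
   terms for the relation [deq] below. *)
Inductive diag (k : fieldType) (L : Type) : nat -> nat -> Type :=
| Id m : diag k L m m
| Braid m n : diag k L (m + n) (n + m)
| Gen m n of gen k L m n : diag k L m n
| Comp m n p of diag k L n p & diag k L m n : diag k L m p
| Tens m n p q of diag k L m n & diag k L p q : diag k L (m + p) (n + q).

Arguments Id {k L} m.
Arguments Braid {k L} m n.

Declare Scope diag_scope.
Delimit Scope diag_scope with D.
Bind Scope diag_scope with diag.
Notation "g \o f" := (Comp g f) : diag_scope.
Notation "f + g" := (Tens f g) : diag_scope.

Definition castd (k : fieldType) (L : Type) (m m' n n' : nat)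
    (em : m = m') (en : n = n') (f : diag k L m n) : diag k L m' n' :=
  ecast i (diag k L i n') em (ecast j (diag k L m j) en f).

(* The axioms of strict symmetric monoidal categories. *)
Inductive deq (k : fieldType) (L : Type) :
    forall m n, diag k L m n -> diag k L m n -> Prop :=
| deq_refl m n (f : diag k L m n) : deq f f
| deq_sym m n (f g : diag k L m n) : deq f g -> deq g f
| deq_trans m n (f g h : diag k L m n) : deq f g -> deq g h -> deq f h
| deq_comp m n p (g g' : diag k L n p) (f f' : diag k L m n) :
    deq g g' -> deq f f' -> deq (g \o f) (g' \o f')
| deq_tens m n p q (f f' : diag k L m n) (g g' : diag k L p q) :
    deq f f' -> deq g g' -> deq (f + g) (f' + g')
| deq_idl m n (f : diag k L m n) : deq (Id n \o f) f
| deq_idr m n (f : diag k L m n) : deq (f \o Id m) f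
| deq_compA m n p q (h : diag k L p q) (g : diag k L n p) (f : diag k L m n) :
    deq (h \o (g \o f)) ((h \o g) \o f)
| deq_tens_id m n : deq (Id m + Id n) (Id (m + n))
| deq_interchange m n p m' n' p' (g : diag k L n p) (f : diag k L m n)
    (g' : diag k L n' p') (f' : diag k L m' n') :
    deq ((g \o f) + (g' \o f')) ((g + g') \o (f + f'))
| deq_tensA m n m' n' m'' n'' (f : diag k L m n) (g : diag k L m' n')
    (h : diag k L m'' n'') :
    deq (castd (addnA m m' m'') (addnA n n' n'') (f + (g + h))) ((f + g) + h)
| deq_unitl m n (f : diag k L m n) :
    deq (castd (add0n m) (add0n n) (Id 0 + f)) f
| deq_unitr m n (f : diag k L m n) :
    deq (castd (addn0 m) (addn0 n) (f + Id 0)) f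
| deq_braid_nat m n p q (f : diag k L m n) (g : diag k L p q) :
    deq (Braid n q \o (f + g)) ((g + f) \o Braid m p)
| deq_braidK m n : deq (Braid n m \o Braid m n) (Id (m + n))
| deq_hexagon m n p :
    deq (Braid m (n + p))
        (castd (erefl _) (addnA n p m) (Id n + Braid m p)
         \o castd (esym (addnA m n p)) (esym (addnA n m p)) (Braid m n + Id p)).

Definition SigFlow (k : fieldType) (m n : nat) : Type := diag k unit m n.

Fixpoint subst_int (k : fieldType) (L L' : Type) (phi : L -> diag k L' 1 1)
    m n (f : diag k L m n) : diag k L' m n :=
  match f in diag _ _ a b return diag k L' a b with
  | Id a => Id a
  | Braid a b => Braid a b
  | Gen _ _ g =>
      match g in gen _ _ a b return diag k L' a b with
      | Add => Gen Add
      | Zero => Gen Zero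
      | Dup => Gen Dup
      | Del => Gen Del
      | Cup => Gen Cup
      | Cap => Gen Cap
      | Scal c => Gen (Scal c)
      | Int l => phi l
      end
  | Comp _ _ _ g h => subst_int phi g \o subst_int phi h
  | Tens _ _ _ _ g h => subst_int phi g + subst_int phi h
  end%D.

Definition forget (k : fieldType) (L : Type) m n (f : diag k L m n) :
    SigFlow k m n :=
  subst_int (fun=> Gen (Int tt)) f.

Fixpoint ints (k : fieldType) (L : Type) m n (f : diag k L m n) : seq L :=
  match f with
  | Id _ | Braid _ _ => [::]
  | Gen _ _ g => if g is Int l then [:: l] else [::]
  | Comp _ _ _ g h => ints g ++ ints h
  | Tens _ _ _ _ g h => ints g ++ ints h
  end.

(* f' presents the morphism f with its integrators numbered by 'I_n, each
   number being used exactly once. *)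
Definition numbering (k : fieldType) (n m p : nat) (f' : diag k 'I_n m p)
    (f : SigFlow k m p) : Prop :=
  perm_eq (ints f') (enum 'I_n) /\ deq (forget f') f.

(* Black-boxing, where the integrator labelled l is replaced by the relation
   I l between the value on the wire entering it and the value on the wire
   leaving it. *)
Definition interp_gen (k : fieldType) (L : Type) (I : L -> k -> k -> Prop)
    m n (g : gen k L m n) : rel_vec k m n :=
  match g in gen _ _ a b return rel_vec k a b with
  | Add => fun x y => y 0 0 = x 0 0 + x 1 0
  | Zero => fun x y => y 0 0 = 0
  | Dup => fun x y => y 0 0 = x 0 0 /\ y 1 0 = x 0 0
  | Del => fun x y => True
  | Cup => fun x y => x 0 0 = x 1 0
  | Cap => fun x y => y 0 0 = y 1 0
  | Scal c => fun x y => y 0 0 = c * x 0 0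
  | Int l => fun x y => I l (x 0 0) (y 0 0)
  end.

Fixpoint interp (k : fieldType) (L : Type) (I : L -> k -> k -> Prop)
    m n (f : diag k L m n) : rel_vec k m n :=
  match f in diag _ _ a b return rel_vec k a b with
  | Id _ => fun x y => y = x
  | Braid a b => fun x y => y = col_mx (dsubmx x) (usubmx x)
  | Gen _ _ g => interp_gen I g
  | Comp _ _ _ g h => fun x y => exists z, interp I h x z /\ interp I g z y
  | Tens _ _ _ _ g h =>
      fun x y => interp I g (usubmx x) (usubmx y)
                 /\ interp I h (dsubmx x) (dsubmx y)
  end.

Definition blackbox (k : fieldType) m n (f : diag k void m n) : rel_vec k m n :=
  interp (fun l : void => match l with end) f.

(* Tensor powers of the generators zeta and !. *)
Fixpoint zeros (k : fieldType) (L : Type) (m : nat) : diag k L 0 m :=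
  match m with
  | 0 => Id 0
  | m'.+1 => (Gen Zero + zeros k L m')%D
  end.

Fixpoint dels (k : fieldType) (L : Type) (p : nat) : diag k L p 0 :=
  match p with
  | 0 => Id 0
  | p'.+1 => (Gen Del + dels k L p')%D
  end.

(* Removing integrator i leaves two loose ends: the wire that entered it, with
   value a, and the wire that left it, with value b.  An end turned into an
   input or output carries the i-th entry of the corresponding vector; capping
   it with zeta imposes b = 0, and capping it with ! leaves a unconstrained. *)
Section StateSpace.

Variables (k : fieldType) (n m p : nat) (f : diag k 'I_n m p).

Definition relA : rel_vec k n n := fun u v =>
  interp (fun i a b => a = v i 0 /\ b = u i 0)
         (dels _ _ p \o (f \o zeros _ _ m)) 0 0.

Definition relB : rel_vec k m n := fun x v =>
  interp (fun i a b => a = v i 0 /\ b = 0) (dels _ _ p \o f) x 0.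

Definition relC : rel_vec k n p := fun u y =>
  interp (fun i a b => b = u i 0) (f \o zeros _ _ m) 0 y.

Definition relD : rel_vec k m p :=
  blackbox (subst_int (fun=> Gen (Scal 0)) f).

End StateSpace.

Definition ContFlow (k : fieldType) (m p : nat) (f : SigFlow k m p) : Prop :=
  exists n (f' : diag k 'I_n m p), numbering f' f /\
    [/\ is_linear_map (relA f'), is_linear_map (relB f'),
        is_linear_map (relC f') & is_linear_map (relD f')].

(* The duality written * : turn around and swap colors. *)
Definition star_gen (k : fieldType) (L : Type) m n (g : gen k L m n) :
    diag k L n m :=
  match g in gen _ _ a b return diag k L b a with
  | Add => Gen Dup
  | Zero => Gen Del
  | Dup => Gen Add
  | Del => Gen Zero
  | Cup => (Id 1 + Gen (Scal (-1))) \o Gen Cap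
  | Cap => Gen Cup \o (Id 1 + Gen (Scal (-1)))
  | Scal c => Gen (Scal c)
  | Int l => Gen (Int l)
  end%D.

Fixpoint star (k : fieldType) (L : Type) m n (f : diag k L m n) :
    diag k L n m :=
  match f in diag _ _ a b return diag k L b a with
  | Id a => Id a
  | Braid a b => Braid b a
  | Gen _ _ g => star_gen g
  | Comp _ _ _ g h => star h \o star g
  | Tens _ _ _ _ g h => star g + star h
  end%D.

(* The duality written with a dagger: turn around using caps and cups. *)
Definition bend (k : fieldType) (L : Type) (g : diag k L 1 1) : diag k L 1 1 :=
  ((Gen Cup + Id 1) \o ((Id 1 + g + Id 1) \o (Id 1 + Gen Cap)))%D.

Definition dagger_gen (k : fieldType) (L : Type) m n (g : gen k L m n) :
    diag k L n m :=
  match g in gen _ _ a b return diag k L b a with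
  | Add =>
      (Id 1 + Id 1 + Gen Cup)
      \o ((Id 1 + Id 1 + Gen Add + Id 1)
          \o (((Id 1 + Gen Cap + Id 1) \o Gen Cap) + Id 1))
  | Zero => Gen Cup \o (Gen Zero + Id 1)
  | Dup =>
      ((Gen Cup \o (Id 1 + Gen Cup + Id 1)) + Id 1)
      \o ((Id 1 + Id 1 + Gen Dup + Id 1) \o (Id 1 + Id 1 + Gen Cap))
  | Del => (Gen Del + Id 1) \o Gen Cap
  | Cup => Gen Cap
  | Cap => Gen Cup
  | Scal c => bend (Gen (Scal c))
  | Int l => bend (Gen (Int l))
  end%D.

Fixpoint dagger (k : fieldType) (L : Type) m n (f : diag k L m n) :
    diag k L n m :=
  match f in diag _ _ a b return diag k L b a with
  | Id a => Id a
  | Braid a b => Braid b a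
  | Gen _ _ g => dagger_gen g
  | Comp _ _ _ g h => dagger h \o dagger g
  | Tens _ _ _ _ g h => dagger g + dagger h
  end%D.

(* f and g have the same black box once their integrators are removed and all
   the resulting loose ends are kept as inputs and outputs. *)
Definition same_blackbox (k : fieldType) m p (f g : SigFlow k m p) : Prop :=
  exists n (f' g' : diag k 'I_n m p),
    [/\ numbering f' f, numbering g' g &
        forall u v : 'cV[k]_n,
          eq_rel (interp (fun i a b => a = v i 0 /\ b = u i 0) f')
                 (interp (fun i a b => a = v i 0 /\ b = u i 0) g')].

(* The subcategory P of SigFlow is a dagger-category via d.  Neither duality
   squares to the identity in the free PROP (the double dual of cap under star
   contains two scalings by -1), so d is required to be its own inverse only
   up to [same_blackbox]; all other laws hold in the free PROP. *)
Record dagger_category (k : fieldType)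
    (P : forall m p, SigFlow k m p -> Prop)
    (d : forall m p, SigFlow k m p -> SigFlow k p m) : Prop := {
  dc_deq : forall m p (f g : SigFlow k m p), deq f g -> P m p f -> P m p g;
  dc_id : forall m, P m m (Id m);
  dc_comp : forall m n p (g : SigFlow k n p) (f : SigFlow k m n),
    P n p g -> P m n f -> P m p (g \o f)%D;
  dc_dual : forall m p (f : SigFlow k m p), P m p f -> P p m (d m p f);
  dc_dual_deq : forall m p (f g : SigFlow k m p),
    P m p f -> P m p g -> deq f g -> deq (d m p f) (d m p g);
  dc_dual_id : forall m, deq (d m m (Id m)) (Id m);
  dc_dual_comp : forall m n p (g : SigFlow k n p) (f : SigFlow k m n),
    P n p g -> P m n f -> deq (d m p (g \o f)%D) (d m n f \o d n p g)%D;
  dc_dualK : forall m p (f : SigFlow k m p),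
    P m p f -> same_blackbox (d p m (d m p f)) f
}.

(* Main.v *)
Require Import Defs.
From mathcomp Require Import all_boot all_order all_algebra all_fingroup ring.
From Stdlib Require Import Classical.

(** Cut all integrators of a diagram open and keep both loose ends of each.  The
    resulting black box is a linear relation from the states [u] (values leaving
    the integrators) and inputs [x] to the derivatives [v] (values entering the
    integrators) and outputs [y].  The relations A, B, C and D are obtained from
    it by setting [x] or [u] to 0 and forgetting [y] or [v], so all four are
    linear maps exactly when the opened black box is the graph of the block
    matrix with rows (A, B) and (C, D) ([state_spaceP]).

    The duality * has a meaning on black boxes: a pair is in the black box of
    the dual if and only if it annihilates the original black box, for the
    pairing that counts inputs and outputs with opposite signs ([interp_star]).
    The difficult case is composition, where an intermediate dual vector must be
    found; it is a common extension of two partial linear functionals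
    ([common_extension]).  The annihilator of the graph of a matrix is the graph
    of its transpose, so dualizing transposes the block matrix, and this is the
    claim: A and D are transposed, B and C are transposed and exchanged
    ([state_space_star]).

    The four relations depend on a numbering of the integrators.  Equations of
    the free PROP match up the integrators of their two sides ([lift_deq]), so two
    numberings of a morphism differ by a permutation of the states
    ([state_space_numbering]).  Closure under composition is the series connection
    of linear systems ([state_space_comp]).

    Both dualities descend to the free PROP because its axioms are stable under
    reversal ([dual_deq]).  The dagger, however, is the converse of relations
    ([interp_dagger]), and the converse of a linear map need not be total: the
    generator zero is in the subPROP, its dagger is not. *)

Set Implicit Arguments.
Unset Strict Implicit.
Unset Printing Implicit Defensive.

Import GRing.Theory.
Local Open Scope ring_scope.

(** * Contravariant functors on the free PROP *)

Section Terms.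
Variables (k : fieldType) (L : Type).

Lemma castd_comp m m' n n' p p' (em : m = m') (en : n = n') (ep : p = p')
    (g : diag k L n p) (f : diag k L m n) :
  (castd en ep g \o castd em en f)%D = castd em ep (g \o f)%D.
Proof. by case: m' / em; case: n' / en; case: p' / ep. Qed.

Lemma castd_Id m m' (em : m = m') : castd em em (Id m) = Id m' :> diag k L m' m'.
Proof. by case: m' / em. Qed.

Lemma castd_deq m m' n n' (em : m = m') (en : n = n') (f g : diag k L m n) :
  deq f g -> deq (castd em en f) (castd em en g).
Proof. by case: m' / em; case: n' / en. Qed.

Lemma deq_tens_braidK m n p :
  deq ((Id n + Braid p m) \o (Id n + Braid m p))%D (Id (n + (m + p)) : diag k L _ _).
Proof.
apply: deq_trans (deq_sym (deq_interchange _ _ _ _)) _.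
apply: deq_trans (deq_tens (deq_idl _) (deq_braidK _ _ _ _)) _.
exact: deq_tens_id.
Qed.

Lemma deq_braid_tensK m n p :
  deq ((Braid n m + Id p) \o (Braid m n + Id p))%D (Id ((m + n) + p) : diag k L _ _).
Proof.
apply: deq_trans (deq_sym (deq_interchange _ _ _ _)) _.
apply: deq_trans (deq_tens (deq_braidK _ _ _ _) (deq_idl _)) _.
exact: deq_tens_id.
Qed.

(** Turning the hexagon around gives the decomposition of the inverse braiding:
    the two factors below are inverse to those of the hexagon, and a braiding
    is inverse to the opposite braiding. *)
Lemma deq_hexagon_inv m n p :
  deq (Braid (n + p) m : diag k L _ _)
      (castd (esym (addnA n m p)) (esym (addnA m n p)) (Braid n m + Id p)
       \o castd (addnA n p m) (erefl _) (Id n + Braid p m))%D.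
Proof.
set Y' := castd (esym (addnA n m p)) _ _.
set X' := castd (addnA n p m) _ _.
pose X : diag k L _ _ := castd (erefl _) (addnA n p m) (Id n + Braid m p)%D.
pose Y : diag k L _ _ :=
  castd (esym (addnA m n p)) (esym (addnA n m p)) (Braid m n + Id p)%D.
have X'X : deq (X' \o X)%D (Id _).
  by rewrite castd_comp; apply: deq_tens_braidK.
have Y'Y : deq (Y' \o Y)%D (Id _).
  rewrite castd_comp -[Id (m + _)](castd_Id (esym (addnA m n p))).
  exact/castd_deq/deq_braid_tensK.
have inv : deq ((Y' \o X') \o (X \o Y))%D (Id _).
  apply: deq_trans (deq_sym (deq_compA _ _ _)) _.
  apply: deq_trans (deq_comp (deq_refl _) (deq_compA _ _ _)) _.
  apply: deq_trans (deq_comp (deq_refl _) (deq_comp X'X (deq_refl _))) _.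
  by apply: deq_trans (deq_comp (deq_refl _) (deq_idl _)) _.
apply: deq_trans (deq_sym (deq_idl _)) _.
apply: deq_trans (deq_comp (deq_sym inv) (deq_refl _)) _.
apply: deq_trans (deq_sym (deq_compA _ _ _)) _.
apply: deq_trans (deq_comp (deq_refl _) _) (deq_idr _).
apply: deq_trans (deq_comp (deq_sym (deq_hexagon _ _ _ _ _)) (deq_refl _)) _.
exact: deq_braidK.
Qed.

(** Every axiom of symmetric monoidal categories, read from right to left along
    composition, is again an axiom up to symmetry, except for the hexagon, which
    is [deq_hexagon_inv].  The images of the generators are arbitrary, so this
    serves both dualities. *)
Lemma dual_deq (d : forall m n, diag k L m n -> diag k L n m)
    (dId : forall m, d m m (Id m) = Id m)
    (dBraid : forall m n, d _ _ (Braid m n) = Braid n m)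
    (dComp : forall m n p (g : diag k L n p) (f : diag k L m n),
       d _ _ (g \o f)%D = (d _ _ f \o d _ _ g)%D)
    (dTens : forall m n p q (f : diag k L m n) (g : diag k L p q),
       d _ _ (f + g)%D = (d _ _ f + d _ _ g)%D)
    m n (f g : diag k L m n) :
  deq f g -> deq (d _ _ f) (d _ _ g).
Proof.
have dcast m1 m2 n1 n2 (em : m1 = m2) (en : n1 = n2) (h : diag k L m1 n1) :
    d _ _ (castd em en h) = castd en em (d _ _ h).
  by case: m2 / em; case: n2 / en.
elim=> {m n f g}; intros; rewrite ?dcast ?(dComp, dTens, dId, dBraid, dcast).
- exact: deq_refl.
- exact: deq_sym.
- by apply: deq_trans; eassumption.
- exact: deq_comp.
- exact: deq_tens.
- exact: deq_idr.
- exact: deq_idl.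
- exact/deq_sym/deq_compA.
- exact: deq_tens_id.
- exact: deq_interchange.
- exact: deq_tensA.
- exact: deq_unitl.
- exact: deq_unitr.
- exact/deq_sym/deq_braid_nat.
- exact: deq_braidK.
- exact: deq_hexagon_inv.
Qed.

Lemma star_deq m n (f g : diag k L m n) : deq f g -> deq (star f) (star g).
Proof. exact: (@dual_deq (fun m n f => @star k L m n f)). Qed.

Lemma dagger_deq m n (f g : diag k L m n) : deq f g -> deq (dagger f) (dagger g).
Proof. exact: (@dual_deq (fun m n f => @dagger k L m n f)). Qed.

End Terms.

(** * Soundness of black-boxing *)

Section Soundness.
Variables (k : fieldType) (L : Type).
Implicit Type I : L -> k -> k -> Prop.

Lemma interp_castd I m m' n n' (em : m = m') (en : n = n') (f : diag k L m n) x y :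
  interp I (castd em en f) x y <->
  interp I f (castmx (esym em, erefl) x) (castmx (esym en, erefl) y).
Proof. by case: m' / em x; case: n' / en y => y x /=; rewrite !castmx_id. Qed.

Lemma castA_submx m n p (e : (m + n + p = m + (n + p))%N)
    (x : 'cV[k]_(m + n + p)) (x' := castmx (e, erefl 1%N) x) :
  [/\ usubmx x' = usubmx (usubmx x), usubmx (dsubmx x') = dsubmx (usubmx x)
    & dsubmx (dsubmx x') = dsubmx x].
Proof.
by split; apply/colP=> i; rewrite !mxE castmxE; congr (x _ _);
  apply: val_inj; rewrite //= addnA.
Qed.

Lemma castAV_submx m n p (e : (m + (n + p) = m + n + p)%N)
    (x : 'cV[k]_(m + (n + p))) (x' := castmx (e, erefl 1%N) x) :
  [/\ usubmx (usubmx x') = usubmx x, dsubmx (usubmx x') = usubmx (dsubmx x)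
    & dsubmx x' = dsubmx (dsubmx x)].
Proof.
by split; apply/colP=> i; rewrite !mxE castmxE; congr (x _ _);
  apply: val_inj; rewrite //= addnA.
Qed.

Lemma eq_col2 m n (x y : 'cV[k]_(m + n)) :
  x = y <-> usubmx x = usubmx y /\ dsubmx x = dsubmx y.
Proof. by split=> [->|[eu ed]] //; rewrite -[x]vsubmxK eu ed vsubmxK. Qed.

Lemma usubmx_unitr m (x : 'cV[k]_m) :
  usubmx (castmx (esym (addn0 m), erefl 1%N) x) = x.
Proof.
apply/colP=> i; rewrite !mxE castmxE; congr (x _ _); by apply: val_inj.
Qed.

Lemma dsubmx_unitl m (x : 'cV[k]_m) :
  dsubmx (castmx (esym (add0n m), erefl 1%N) x : 'cV_(0 + m)) = x.
Proof.
apply/colP=> i; rewrite !mxE castmxE; congr (x _ _); by apply: val_inj.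
Qed.

(** Black-boxing factors through the free PROP, because relations with direct
    sum satisfy the axioms of strict symmetric monoidal categories. *)
Lemma interp_deq I m n (f g : diag k L m n) :
  deq f g -> eq_rel (interp I f) (interp I g).
Proof.
elim=> {m n f g} /=.
- by [].
- by move=> m n f g _ fg x y; rewrite fg.
- by move=> m n f g h _ fg _ gh x y; rewrite fg.
- move=> m n p g g' f f' _ gg _ ff x y.
  by split=> -[z [/ff ? /gg ?]]; exists z.
- by move=> m n p q f f' g g' _ ff _ gg x y; rewrite ff gg.
- by move=> m n f x y; split=> [[z [? ->]]|?] //; exists y.
- by move=> m n f x y; split=> [[z [-> ?]]|?] //; exists x.
- move=> m n p q h g f x y; split.
    by move=> [z [[w [? ?]] ?]]; exists w; split=> //; exists z.
  by move=> [w [? [z [? ?]]]]; exists z; split=> //; exists w.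
- move=> m n x y; split=> [[eu ed]|->] //.
  by rewrite -[y]vsubmxK eu ed vsubmxK.
- move=> m n p m' n' p' g f g' f' x y; split.
    move=> [[z [? ?]] [z' [? ?]]]; exists (col_mx z z').
    by rewrite col_mxKu col_mxKd.
  move=> [z [[? ?] [? ?]]].
  by split; [exists (usubmx z)|exists (dsubmx z)].
- move=> m n m' n' m'' n'' f g h x y; rewrite interp_castd /=.
  have [-> -> ->] := castA_submx (esym (addnA m m' m'')) x.
  by have [-> -> ->] := castA_submx (esym (addnA n n' n'')) y; tauto.
- move=> m n f x y; rewrite interp_castd /= !dsubmx_unitl.
  by split=> [[]|] //; split=> //; rewrite !flatmx0.
- move=> m n f x y; rewrite interp_castd /= !usubmx_unitr.
  by split=> [[]|] //; split=> //; rewrite !flatmx0.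
- move=> m n p q f g x y; split.
    move=> [z [[fz gz] ->]]; exists (col_mx (dsubmx x) (usubmx x)).
    by rewrite !col_mxKu !col_mxKd.
  move=> [z [-> ]]; rewrite !col_mxKu !col_mxKd => -[gx fx].
  exists (col_mx (dsubmx y) (usubmx y)).
  by rewrite !col_mxKu !col_mxKd vsubmxK.
- move=> m n x y; split=> [[z [-> ->]]|->].
    by rewrite !col_mxKu !col_mxKd vsubmxK.
  by eexists; split; first by []; rewrite !col_mxKu !col_mxKd vsubmxK.
- move=> m n p x y.
  (* The two stages of the hexagon, each as an explicit function of its input
     or of the intermediate value. *)
  have step1 z : interp I (castd (esym (addnA m n p)) (esym (addnA n m p))
      (Braid m n + Id p)%D) x z <->
      z = col_mx (usubmx (dsubmx x)) (col_mx (usubmx x) (dsubmx (dsubmx x))).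
    rewrite interp_castd /= !eq_col2 !col_mxKu !col_mxKd.
    have [-> -> ->] := castAV_submx (esym (esym (addnA m n p))) x.
    have [-> -> ->] := castAV_submx (esym (esym (addnA n m p))) z.
    by rewrite !col_mxKu; tauto.
  have step2 z : interp I (castd erefl (addnA n p m) (Id n + Braid m p)%D) z y <->
      y = col_mx (col_mx (usubmx z) (dsubmx (dsubmx z))) (usubmx (dsubmx z)).
    rewrite interp_castd /= castmx_id !eq_col2 !col_mxKu !col_mxKd.
    have [-> -> ->] := castA_submx (esym (addnA n p m)) y.
    by tauto.
  split=> [ey|[z [/step1 -> /step2 ->]]].
    exists (col_mx (usubmx (dsubmx x)) (col_mx (usubmx x) (dsubmx (dsubmx x)))).
    by split; [apply/step1|apply/step2; rewrite !(col_mxKu, col_mxKd) vsubmxK].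
  by rewrite !(col_mxKu, col_mxKd) vsubmxK.
Qed.

End Soundness.

(** * Labels of integrators *)

Section Labels.
Variable k : fieldType.

Definition relabel (L L' : Type) (phi : L -> L') m n (f : diag k L m n) :
    diag k L' m n :=
  subst_int (fun l => Gen (Int (phi l))) f.

(** The labels in [s] are handed out to the integrators in the order of [ints];
    the value on an integrator is arbitrary when [s] is too short. *)
Fixpoint label (L L' : Type) m n (f : diag k L m n) (s : seq L') :
    diag k L' m n :=
  match f in diag _ _ a b return diag k L' a b with
  | Id a => Id a
  | Braid a b => Braid a b
  | Gen _ _ g =>
      match g in gen _ _ a b return diag k L' a b with
      | Add => Gen Add
      | Zero => Gen Zero
      | Dup => Gen Dup
      | Del => Gen Del
      | Cup => Gen Cup
      | Cap => Gen Cap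
      | Scal c => Gen (Scal c)
      | Int _ => if s is l :: _ then Gen (Int l) else Id 1
      end
  | Comp _ _ _ g h =>
      label g (take (size (ints g)) s) \o label h (drop (size (ints g)) s)
  | Tens _ _ _ _ g h =>
      label g (take (size (ints g)) s) + label h (drop (size (ints g)) s)
  end%D.

Lemma label_comp L L' m n p (g : diag k L n p) (f : diag k L m n)
    (s1 s2 : seq L') : size s1 = size (ints g) ->
  label (g \o f)%D (s1 ++ s2) = (label g s1 \o label f s2)%D.
Proof. by move=> e /=; rewrite -e take_size_cat // drop_size_cat. Qed.

Lemma label_tens L L' m n p q (g : diag k L n p) (f : diag k L m q)
    (s1 s2 : seq L') : size s1 = size (ints g) ->
  label (g + f)%D (s1 ++ s2) = (label g s1 + label f s2)%D.
Proof. by move=> e /=; rewrite -e take_size_cat // drop_size_cat. Qed.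

Lemma size_catP (T : Type) (s : seq T) a b : size s = (a + b)%N ->
  exists s1 s2, [/\ s = s1 ++ s2, size s1 = a & size s2 = b].
Proof.
move=> e; exists (take a s), (drop a s); split; first by rewrite cat_take_drop.
  by rewrite size_takel // e leq_addr.
by rewrite size_drop e addKn.
Qed.

Lemma ints_label L L' m n (f : diag k L m n) (s : seq L') :
  size s = size (ints f) -> ints (label f s) = s.
Proof.
elim: f s => {m n} [m|m n|m n []|m n p g IHg f IHf|m n p q g IHg f IHf] //=;
  try by [case|move=> ? []|move=> ? [|? []]].
all: move=> s; rewrite size_cat => /size_catP[s1 [s2 [-> e1 e2]]].
all: by rewrite -e1 take_size_cat // drop_size_cat // IHg // IHf.
Qed.

Lemma forget_label L L' m n (f : diag k L m n) (s : seq L') :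
  size s = size (ints f) -> forget (label f s) = forget f.
Proof.
elim: f s => {m n} [m|m n|m n []|m n p g IHg f IHf|m n p q g IHg f IHf] //=;
  try by [case|move=> ? []|move=> ? [|? []]].
all: move=> s; rewrite size_cat => /size_catP[s1 [s2 [-> e1 e2]]].
all: rewrite -e1 take_size_cat // drop_size_cat // /forget /=.
all: by rewrite [subst_int _ (label g _)]IHg // [subst_int _ (label f _)]IHf.
Qed.

Lemma forget_id m n (f : SigFlow k m n) : forget f = f.
Proof.
elim: f => {m n} [m|m n|m n []|m n p g IHg f IHf|m n p q g IHg f IHf] //=.
- by case.
- by rewrite -[in RHS]IHg -[in RHS]IHf.
- by rewrite -[in RHS]IHg -[in RHS]IHf.
Qed.

Lemma ints_relabel L L' (phi : L -> L') m n (f : diag k L m n) :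
  ints (relabel phi f) = map phi (ints f).
Proof.
elim: f => {m n} [m|m n|m n []|m n p g IHg f IHf|m n p q g IHg f IHf] //=.
all: by rewrite map_cat -IHg -IHf.
Qed.

Lemma forget_relabel L L' (phi : L -> L') m n (f : diag k L m n) :
  forget (relabel phi f) = forget f.
Proof.
rewrite /forget /relabel.
by elim: f => {m n} [m|m n|m n []|m n p g IHg f IHf|m n p q g IHg f IHf] //=;
  rewrite IHg IHf.
Qed.

Lemma label_forget L m n (f : diag k L m n) : label (forget f) (ints f) = f.
Proof.
elim: f => {m n} [m|m n|m n []|m n p g IHg f IHf|m n p q g IHg f IHf] //=.
all: have -> : size (ints (subst_int (fun=> Gen (Int tt)) g)) = size (ints g)
  by rewrite -[RHS](size_map (fun=> tt)) -ints_relabel.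
all: by rewrite take_size_cat // drop_size_cat // -[in RHS]IHg -[in RHS]IHf.
Qed.

Lemma label_map L L' L'' (phi : L' -> L'') m n (f : diag k L m n) s :
  label f (map phi s) = relabel phi (label f s).
Proof.
elim: f s => {m n} [m|m n|m n []|m n p g IHg f IHf|m n p q g IHg f IHf] //=.
1: by move=> l [].
all: by move=> s; rewrite -map_take -map_drop IHg IHf.
Qed.

(** An equation between diagrams that ignores labels lifts to an equation between
    labelled diagrams: the occurrences of integrators on the two sides
    correspond, although possibly in a different order. *)
Definition lifts L m n (f g : diag k L m n) := forall (L' : eqType) (s : seq L'),
  size s = size (ints f) ->
  exists2 s', perm_eq s' s & deq (label f s) (label g s').

Lemma lifts_refl L m n (f : diag k L m n) : lifts f f.
Proof. by move=> L' s _; exists s => //; apply: deq_refl. Qed.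

Lemma label_castd L L' m m' n n' (em : m = m') (en : n = n') (f : diag k L m n)
    (s : seq L') : label (castd em en f) s = castd em en (label f s).
Proof. by case: m' / em; case: n' / en. Qed.

Lemma ints_castd L m m' n n' (em : m = m') (en : n = n') (f : diag k L m n) :
  ints (castd em en f) = ints f.
Proof. by case: m' / em; case: n' / en. Qed.

Lemma lifts_same L m n (f g : diag k L m n) :
  (forall (L' : eqType) (s : seq L'), size s = size (ints f) ->
     deq (label f s) (label g s)) ->
  size (ints f) = size (ints g) ->
  lifts f g /\ lifts g f.
Proof.
move=> fg e; split=> L' s es; exists s => //; first exact: fg.
by apply/deq_sym/fg; rewrite e.
Qed.

Lemma ints_comp L m n p (g : diag k L n p) (f : diag k L m n) :
  ints (g \o f)%D = ints g ++ ints f.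
Proof. by []. Qed.

Lemma ints_tens L m n p q (g : diag k L n p) (f : diag k L m q) :
  ints (g + f)%D = ints g ++ ints f.
Proof. by []. Qed.

Lemma size_ints_deq L m n (f g : diag k L m n) :
  deq f g -> size (ints f) = size (ints g).
Proof.
elim=> {m n f g}; intros; rewrite ?(ints_castd, ints_comp) /= ?cats0 ?size_cat /=;
  rewrite ?size_cat ?addnA //.
- congruence.
- congruence.
- congruence.
- by rewrite -!addnA [(size (ints f) + (_ + _))%N]addnCA.
- by rewrite addnC.
Qed.

(** Each axiom uses every integrator of the one side exactly once on the other.
    Only the interchange law and the naturality of the braiding change the
    order of occurrence.  Both directions are carried along because the
    equations are closed under symmetry. *)
Lemma lift_deq L m n (f g : diag k L m n) :
  deq f g -> lifts f g /\ lifts g f.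
Proof.
elim=> {m n f g}.
- by move=> m n f; split; apply: lifts_refl.
- by move=> m n f g _ [].
- move=> m n f g h fg [Hfg Hgf] gh [Hgh Hhg].
  have trans f1 f2 f3 : deq f1 f2 -> lifts f1 f2 -> lifts f2 f3 -> @lifts L m n f1 f3.
    move=> /size_ints_deq e12 l12 l23 L' s es.
    have [s' ps d12] := l12 _ s es.
    have [|s'' ps' d23] := l23 _ s'; first by rewrite (perm_size ps) es.
    by exists s''; [apply: perm_trans ps' ps|apply: deq_trans d12 d23].
  by split; [apply: (trans _ g)|apply: (trans _ g) => //; apply: deq_sym].
- have comp m n p (g g' : diag k L n p) (f f' : diag k L m n) : deq g g' ->
      lifts g g' -> lifts f f' -> lifts (g \o f)%D (g' \o f')%D.
    move=> /size_ints_deq eg lg lf L' s; rewrite ints_comp size_cat.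
    move=> /size_catP[s1 [s2 [-> e1 e2]]].
    have [s1' ps1 d1] := lg _ s1 e1; have [s2' ps2 d2] := lf _ s2 e2.
    exists (s1' ++ s2'); first exact: perm_cat.
    rewrite !label_comp //; last by rewrite (perm_size ps1) e1.
    exact: deq_comp.
  by move=> m n p g g' f f' dg [? ?] df [? ?]; split; apply: comp => //; apply: deq_sym.
- have tens m n p q (g g' : diag k L n p) (f f' : diag k L m q) : deq g g' ->
      lifts g g' -> lifts f f' -> lifts (g + f)%D (g' + f')%D.
    move=> /size_ints_deq eg lg lf L' s; rewrite !(ints_comp, ints_tens) size_cat.
    move=> /size_catP[s1 [s2 [-> e1 e2]]].
    have [s1' ps1 d1] := lg _ s1 e1; have [s2' ps2 d2] := lf _ s2 e2.
    exists (s1' ++ s2'); first exact: perm_cat.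
    rewrite !label_tens //; last by rewrite (perm_size ps1) e1.
    exact: deq_tens.
  by move=> m n p q f f' g g' df [? ?] dg [? ?]; split; apply: tens => //; apply: deq_sym.
- move=> m n f; apply: lifts_same => //= L' s es.
  by rewrite drop0; apply: deq_idl.
- move=> m n f; apply: lifts_same => [L' s es|]; last by rewrite /= cats0.
  rewrite -{1}[s]cats0 label_comp; first exact: deq_idr.
  by rewrite es /= cats0.
- move=> m n p q h g f; apply: lifts_same => [L' s|]; last by rewrite /= catA.
  rewrite !ints_comp size_cat => /size_catP[s1 [s' [-> e1]]].
  rewrite size_cat => /size_catP[s2 [s3 [-> e2 e3]]].
  rewrite label_comp // label_comp // catA label_comp; last first.
    by rewrite ints_comp !size_cat e1 e2.
  by rewrite label_comp //; apply: deq_compA.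
- by move=> m n; apply: lifts_same => //= L' s _; apply: deq_tens_id.
- move=> m n p m' n' p' g f g' f'; split=> L' s.
    rewrite !(ints_comp, ints_tens) !size_cat => /size_catP[s1 [s2 [->]]].
    move=> /size_catP[s3 [s4 [-> e3 e4]]] /size_catP[s5 [s6 [-> e5 e6]]].
    exists ((s3 ++ s5) ++ (s4 ++ s6)); first by rewrite perm_catACA.
    rewrite label_tens ?size_cat ?e3 ?e4 //.
    rewrite label_comp // label_comp // label_comp ?ints_tens ?size_cat ?e3 ?e5 //.
    by rewrite label_tens // label_tens //; apply: deq_interchange.
  rewrite !(ints_comp, ints_tens) !size_cat => /size_catP[s1 [s2 [->]]].
  move=> /size_catP[s3 [s4 [-> e3 e4]]] /size_catP[s5 [s6 [-> e5 e6]]].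
  exists ((s3 ++ s5) ++ (s4 ++ s6)); first by rewrite perm_catACA.
  rewrite label_comp ?ints_tens ?size_cat ?e3 ?e4 //.
  rewrite label_tens // label_tens // label_tens ?ints_comp ?size_cat ?e3 ?e5 //.
  by rewrite label_comp // label_comp //; apply/deq_sym/deq_interchange.
- move=> m n m' n' m'' n'' f g h; apply: lifts_same => [L' s|]; last first.
    by rewrite ints_castd /= catA.
  rewrite label_castd ints_castd !ints_tens size_cat => /size_catP[s1 [s' [-> e1]]].
  rewrite size_cat => /size_catP[s2 [s3 [-> e2 e3]]].
  rewrite label_tens // label_tens // catA label_tens; last first.
    by rewrite /= !size_cat e1 e2.
  by rewrite label_tens //; apply: deq_tensA.
- move=> m n f; apply: lifts_same => [L' s|]; last by rewrite ints_castd.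
  by rewrite label_castd /= drop0 => _; apply: deq_unitl.
- move=> m n f; apply: lifts_same => [L' s|]; last by rewrite ints_castd /= cats0.
  rewrite ints_castd /= cats0 => es; rewrite label_castd -{1}[s]cats0 label_tens //.
  by apply: deq_unitr.
- move=> m n p q f g; split=> L' s.
    rewrite ints_comp ints_tens [ints (Braid _ _)]/= cat0s size_cat.
    move=> /size_catP[s1 [s2 [-> e1 e2]]].
    exists (s2 ++ s1); first by rewrite perm_catC.
    rewrite -[s1 ++ s2]cat0s label_comp // label_tens //.
    rewrite -[s2 ++ s1]cats0 label_comp; last first.
      by rewrite ints_tens !size_cat e1 e2.
    by rewrite label_tens //; apply: deq_braid_nat.
  rewrite ints_comp ints_tens [ints (Braid _ _)]/= cats0 size_cat.
  move=> /size_catP[s1 [s2 [-> e1 e2]]].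
  exists (s2 ++ s1); first by rewrite perm_catC.
  rewrite -[s1 ++ s2]cats0 label_comp; last first.
    by rewrite ints_tens !size_cat e1 e2.
  rewrite label_tens // -[s2 ++ s1]cat0s label_comp // label_tens //.
  exact/deq_sym/deq_braid_nat.
- by move=> m n; apply: lifts_same => //= L' s _; apply: deq_braidK.
- move=> m n p; apply: lifts_same => [L' s _|].
    rewrite -[s]cat0s label_comp ?ints_castd // !label_castd.
    exact: deq_hexagon.
  by rewrite ints_comp !ints_castd.
Qed.

End Labels.

(** * Black boxes with opened integrators *)

Section Opened.
Variable k : fieldType.

Lemma interp_ext (L : eqType) (I J : L -> k -> k -> Prop) m n (f : diag k L m n) :
  (forall l, l \in ints f -> forall a b, I l a b <-> J l a b) ->
  eq_rel (interp I f) (interp J f).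
Proof.
elim: f => {m n} [m|m n|m n [||||||c|l]|m n p g IHg f IHf|m n p q g IHg f IHf] //= IJ x y.
- by apply: IJ; rewrite inE.
all: have {}IHg : eq_rel (interp I g) (interp J g)
  by apply: IHg => l lin; apply: IJ; rewrite mem_cat lin.
all: have {}IHf : eq_rel (interp I f) (interp J f)
  by apply: IHf => l lin; apply: IJ; rewrite mem_cat lin orbT.
- by split=> -[z [/IHf ? /IHg ?]]; exists z.
- by rewrite IHg IHf.
Qed.

Lemma interp_subst L L' (phi : L -> diag k L' 1 1) (I : L' -> k -> k -> Prop)
    (J : L -> k -> k -> Prop) :
  (forall l x y, interp I (phi l) x y <-> J l (x 0 0) (y 0 0)) ->
  forall m n (f : diag k L m n), eq_rel (interp I (subst_int phi f)) (interp J f).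
Proof.
move=> phiJ m n f.
elim: f => {m n} [m|m n|m n [||||||c|l]|m n p g IHg f IHf|m n p q g IHg f IHf] //= x y.
- by split=> -[z [/IHf ? /IHg ?]]; exists z.
- by rewrite IHg IHf.
Qed.

Lemma interp_relabel L L' (phi : L -> L') (I : L' -> k -> k -> Prop)
    m n (f : diag k L m n) :
  eq_rel (interp I (relabel phi f)) (interp (fun l => I (phi l)) f).
Proof. exact: interp_subst. Qed.

(** Integrator [i] is cut open: the wire entering it carries [v i], the wire
    leaving it carries [u i]. *)
Definition port L (u v : L -> k) : L -> k -> k -> Prop :=
  fun i a b => a = v i /\ b = u i.

Lemma interp_port0 L m n (f : diag k L m n) :
  interp (port (fun=> 0) (fun=> 0)) f 0 0.
Proof.
elim: f => {m n} [m|m n|m n [||||||c|l]|m n p g IHg f IHf|m n p q g IHg f IHf] /=.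
11: by exists 0.
11: by rewrite !linear0.
2: by rewrite !linear0 col_mx0.
all: by rewrite ?mxE ?addr0 ?mulr0 //; split; rewrite ?mxE.
Qed.

(** Together with [interp_port0]: a black box is a linear subspace, jointly in the
    boundary values and the values on the cut wires. *)
Lemma interp_port_linear L (c : k) (u1 u2 v1 v2 : L -> k) m n (f : diag k L m n)
    x1 x2 y1 y2 :
  interp (port u1 v1) f x1 y1 -> interp (port u2 v2) f x2 y2 ->
  interp (port (fun i => c * u1 i + u2 i) (fun i => c * v1 i + v2 i)) f
    (c *: x1 + x2) (c *: y1 + y2).
Proof.
elim: f x1 x2 y1 y2 =>
  {m n} [m|m n|m n [||||||d|l]|m n p g IHg f IHf|m n p q g IHg f IHf] //= x1 x2 y1 y2.
- by move=> -> ->.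
- by move=> -> ->; rewrite !linearP /= -add_col_mx -scale_col_mx.
- by rewrite !mxE => -> ->; ring.
- by rewrite !mxE => -> ->; ring.
- by rewrite !mxE => -[-> ->] [-> ->].
- by rewrite !mxE => -> ->.
- by rewrite !mxE => -> ->.
- by rewrite !mxE => -> ->; ring.
- by move=> [e1 e2] [e3 e4]; split; rewrite !mxE ?e1 ?e2 ?e3 ?e4.
- by move=> [z1 [? ?]] [z2 [? ?]]; exists (c *: z1 + z2); split; auto.
- by move=> [? ?] [? ?]; rewrite !linearP; auto.
Qed.

(** Values on the wires of two subdiagrams are combined according to which of the
    two contains the integrator. *)
Definition glue (L : eqType) (T : Type) (s : seq L) (u1 u2 : L -> T) : L -> T :=
  fun i => if i \in s then u1 i else u2 i.

Lemma glueL (L : eqType) T (s : seq L) (u1 u2 : L -> T) i :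
  i \in s -> glue s u1 u2 i = u1 i.
Proof. by rewrite /glue => ->. Qed.

Lemma glueR (L : eqType) T (s t : seq L) (u1 u2 : L -> T) i :
  uniq (s ++ t) -> i \in t -> glue s u1 u2 i = u2 i.
Proof.
rewrite cat_uniq => /and3P[_ /hasPn st _] it.
by rewrite /glue (negPf (st _ it)).
Qed.

(** When no label is repeated, choosing a value separately at each integrator is
    the same as choosing one function of the labels. *)
Lemma interp_choose (L : eqType) (T : Type) (t0 : T) (J : L -> T -> k -> k -> Prop)
    m n (f : diag k L m n) x y : uniq (ints f) ->
  interp (fun l a b => exists c, J l c a b) f x y <->
  exists w : L -> T, interp (fun l => J l (w l)) f x y.
Proof.
move=> uf; split; last first.
  move=> [w]; elim: f uf x y =>
    {m n} [m|m n|m n [||||||c|l]|m n p g IHg f IHf|m n p q g IHg f IHf] //= + x y.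
  - by exists (w l).
  - rewrite cat_uniq => /and3P[ug _ uf] [z [? ?]]; exists z; split; auto.
  - rewrite cat_uniq => /and3P[ug _ uf] [? ?]; split; auto.
elim: f uf x y =>
  {m n} [m|m n|m n g|m n p g IHg f IHf|m n p q g IHg f IHf] uf x y.
- by exists (fun=> t0).
- by exists (fun=> t0).
- case: g uf x y => /=; try by exists (fun=> t0).
  by move=> l _ x y [c ?]; exists (fun=> c).
- move: uf => /= ufg; move: (ufg); rewrite cat_uniq => /and3P[ug _ uf].
  move=> [z [/(IHf uf)[wf fz] /(IHg ug)[wg gz]]].
  exists (glue (ints g) wg wf), z; split; [move: fz|move: gz]; apply interp_ext => l lin a b.
    by rewrite (glueR _ _ ufg).
  by rewrite glueL.
- move: uf => /= ufg; move: (ufg); rewrite cat_uniq => /and3P[ug _ uf].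
  move=> [/(IHg ug)[wg gz] /(IHf uf)[wf fz]].
  exists (glue (ints g) wg wf); split; [move: gz|move: fz]; apply interp_ext => l lin a b.
    by rewrite glueL.
  by rewrite (glueR _ _ ufg).
Qed.

End Opened.

(** * Coordinates of small vectors *)

Section Coordinates.
Variable k : fieldType.

(** Indexing by [nat] makes the entries of blocks, and of vectors whose dimensions
    are convertible but not syntactically equal, comparable by computation. *)
Definition entry n (x : 'cV[k]_n) (i : nat) : k :=
  if insub i is Some j then x j 0 else 0.

Definition cvec n (s : seq k) : 'cV[k]_n := \col_i nth 0 s i.

Lemma entryE n (x : 'cV[k]_n) (i : 'I_n) (j : 'I_1) : x i j = entry x i.
Proof. by rewrite /entry valK ord1. Qed.

Lemma entry_usubmx m n (x : 'cV[k]_(m + n)) i :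
  (i < m)%N -> entry (usubmx x) i = entry x i.
Proof.
move=> im; have := entryE (usubmx x) (Ordinal im) 0; rewrite mxE => /= <-.
exact: entryE.
Qed.

Lemma entry_dsubmx m n (x : 'cV[k]_(m + n)) i :
  (i < n)%N -> entry (dsubmx x) i = entry x (m + i).
Proof.
move=> im; have := entryE (dsubmx x) (Ordinal im) 0; rewrite mxE => /= <-.
exact: entryE.
Qed.

Lemma entry_cvec n s i : (i < n)%N -> entry (cvec n s) i = nth 0 s i.
Proof. by move=> lt_in; rewrite -[i]/(val (Ordinal lt_in)) -(entryE _ _ 0) mxE. Qed.

Lemma eq_cV1 (x y : 'cV[k]_1) : x = y <-> entry x 0 = entry y 0.
Proof.
split=> [->|] //; rewrite -!(entryE _ 0 0) => e.
by apply/colP=> i; rewrite ord1.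
Qed.

Lemma entry2_1 (x : 'cV[k]_2) (j : 'I_1) : x 1 j = entry x 1.
Proof. exact: entryE. Qed.

Definition coords := (entry2_1, entryE, entry_usubmx, entry_dsubmx, entry_cvec).

End Coordinates.

(** Beyond rewriting with [coords], indices and dimensions such as 1 + 1 are
    evaluated, so that equal entries become syntactically equal. *)
Ltac coords :=
  rewrite ?coords //=;
  repeat match goal with |- context [@entry ?K ?n ?x ?i] =>
    let n' := eval vm_compute in n in
    let j := eval vm_compute in i in
    lazymatch constr:((n, i)) with
    | (n', j) => fail
    | _ => change (@entry K n x i) with (@entry K n' x j)
    end
  end.

Ltac coords_intro :=
  repeat lazymatch goal with
  | |- ex _ -> _ => case=> ?
  | |- (_ /\ _) -> _ => case
  | |- @eq (matrix _ _ _) _ _ -> _ => move/eq_cV1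
  | |- _ -> _ => coords; move=> ?
  end.

Ltac coords_split :=
  rewrite /=;
  repeat lazymatch goal with
  | |- _ /\ _ => split
  | |- @eq (matrix _ _ _) _ _ => apply/eq_cV1
  end; coords.

(** * The dagger is the converse; double duals *)

Section Converse.
Variable k : fieldType.

(** The snake: a bent wire runs through the relation backwards. *)
Lemma interp_bend L (I : L -> k -> k -> Prop) (J : k -> k -> Prop) (g : diag k L 1 1) :
  (forall x y, interp I g x y <-> J (x 0 0) (y 0 0)) ->
  forall x y, interp I (bend g) x y <-> J (y 0 0) (x 0 0).
Proof.
move=> gJ x y; rewrite /bend /=; split.
  case=> z [[w [[+ +] [[+ /gJ +] +]]]]; coords_intro; coords.
  by congruence.
move=> Jyx; exists (cvec 3 [:: x 0 0; x 0 0; y 0 0]); split.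
  exists (cvec 3 [:: x 0 0; y 0 0; y 0 0]).
  split; last split; first by coords_split.
    split; first by coords_split.
    by apply/gJ; move: Jyx; coords.
  by coords_split.
by coords_split.
Qed.

Lemma interp_dagger_gen L (I : L -> k -> k -> Prop) m n (g : gen k L m n) :
  forall x y, interp I (dagger_gen g) y x <-> interp_gen I g x y.
Proof.
case: g => [||||||c|l] x y; rewrite [dagger_gen _]/=.
- split.
    (* The bent addition receives its two summands in the opposite order. *)
    move=> dagger_yx; suff: interp_gen I Add (cvec 2 [:: x 1 0; x 0 0]) y.
      by rewrite /=; coords; rewrite addrC.
    by move: dagger_yx; rewrite /=; coords_intro; coords; congruence.
  move=> e; exists (cvec 4 [:: x 0 0; x 1 0; y 0 0; y 0 0]); split.
    exists (cvec 5 [:: x 0 0; x 1 0; x 1 0; x 0 0; y 0 0]); split.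
      split; last by coords_split.
      by exists (cvec 2 [:: x 0 0; x 0 0]); coords_split.
    by coords_split; rewrite addrC; move: e => /=; coords.
  by coords_split.
- split; first by rewrite /=; coords_intro; coords; congruence.
  by move=> e; exists (cvec 2 [:: 0; y 0 0]); move: e => /=; coords => e; coords_split.
- split; first by rewrite /=; coords_intro; coords; split; congruence.
  case; coords => e0 e1; exists (cvec 5 [:: y 0 0; y 1 0; x 0 0; x 0 0; x 0 0]).
  split; first by exists (cvec 4 [:: y 0 0; y 1 0; x 0 0; x 0 0]); coords_split.
  split; last by coords_split.
  by exists (cvec 2 [:: y 0 0; x 0 0]); coords_split.
- split=> // _.
  exists (cvec 2 [:: x 0 0; x 0 0]); coords_split.
- by [].
- by [].
- by apply: (interp_bend (J := fun a b => b = c * a)).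
- by apply: (interp_bend (J := fun a b => I l a b)).
Qed.

(** Taking converses reverses composition and respects direct sums, so the
    generators decide.  In particular the dagger is its own inverse on black
    boxes. *)
Lemma interp_dagger L (I : L -> k -> k -> Prop) m n (f : diag k L m n) :
  forall x y, interp I (dagger f) y x <-> interp I f x y.
Proof.
elim: f => {m n} [m|m n|m n g|m n p g IHg f IHf|m n p q g IHg f IHf] x y.
- by split=> ->.
- by rewrite /= !eq_col2 !col_mxKu !col_mxKd; split=> -[-> ->].
- exact: interp_dagger_gen.
- by split=> -[z [h1 h2]]; exists z; split; (apply/IHf || apply/IHg).
- by rewrite /= IHg IHf.
Qed.

(** The double dual changes only cups and caps, by two scalings with -1, which
    cancel in the black box. *)
Lemma interp_star2 L (I : L -> k -> k -> Prop) m n (f : diag k L m n) :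
  eq_rel (interp I (star (star f))) (interp I f).
Proof.
elim: f => {m n} [m|m n|m n [||||||c|l]|m n p g IHg f IHf|m n p q g IHg f IHf] //= x y.
- split.
    move=> [z [[/eq_cV1 + +] [w [[/eq_cV1 + +] +]]]]; coords.
    by rewrite !mulN1r => -> -> ->; rewrite opprK => -> ->.
  move=> e; exists (cvec 2 [:: x 0 0; - x 1 0]); split.
    by coords_split; rewrite mulN1r.
  exists (cvec 2 [:: x 0 0; x 1 0]); split; last by move: e; coords.
  by coords_split; rewrite mulN1r opprK.
- split.
    move=> [z [[w [+ [/eq_cV1 + +]]] [/eq_cV1 + +]]]; coords.
    by rewrite !mulN1r => -> -> -> -> ->; rewrite opprK.
  move=> e; exists (cvec 2 [:: y 0 0; - y 1 0]); split; last first.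
    by coords_split; rewrite mulN1r opprK.
  exists (cvec 2 [:: y 0 0; y 1 0]); split; first by move: e; coords.
  by coords_split; rewrite mulN1r.
- by split=> -[z [/IHf ? /IHg ?]]; exists z.
- by rewrite IHg IHf.
Qed.

End Converse.

(** * Extension of linear functionals *)

Section Functionals.
Variable k : fieldType.

Definition dotp n (x y : 'cV[k]_n) : k := \sum_i x i 0 * y i 0.

Lemma dotp0 n (x : 'cV[k]_n) : dotp x 0 = 0.
Proof. by rewrite /dotp big1 // => i _; rewrite mxE mulr0. Qed.

Lemma dotp_linear n (x : 'cV[k]_n) c y z : dotp x (c *: y + z) = c * dotp x y + dotp x z.
Proof.
rewrite /dotp mulr_sumr -big_split; apply: eq_bigr => i _.
by rewrite !mxE mulrDr mulrCA.
Qed.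

Lemma dotp_split m n (x y : 'cV[k]_(m + n)) :
  dotp x y = dotp (usubmx x) (usubmx y) + dotp (dsubmx x) (dsubmx y).
Proof.
by rewrite /dotp big_split_ord; congr (_ + _); apply: eq_bigr => i _; rewrite !mxE.
Qed.

Lemma dotp_mul m n (M : 'M[k]_(m, n)) (x : 'cV[k]_m) (y : 'cV[k]_n) :
  dotp x (M *m y) = dotp (M^T *m x) y.
Proof.
have dotpE p (a b : 'cV[k]_p) : dotp a b = (a^T *m b) 0 0.
  by rewrite mxE; apply: eq_bigr => i _; rewrite mxE.
by rewrite !dotpE trmx_mul trmxK mulmxA.
Qed.

Lemma dotp_delta n (x : 'cV[k]_n) i : dotp x (delta_mx i 0) = x i 0.
Proof.
rewrite /dotp (bigD1 i) //= big1 => [|j /negPf ji]; rewrite mxE.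
  by rewrite !eqxx mulr1 addr0.
by rewrite ji mulr0.
Qed.

Lemma dotp_inj n (x y : 'cV[k]_n) : (forall z, dotp x z = dotp y z) -> x = y.
Proof. by move=> xy; apply/colP=> i; rewrite -!dotp_delta. Qed.

Lemma dotp1 (x y : 'cV[k]_1) : dotp x y = entry x 0 * entry y 0.
Proof. by rewrite /dotp big_ord1 !coords. Qed.

Lemma dotp2 (x y : 'cV[k]_2) :
  dotp x y = entry x 0 * entry y 0 + entry x 1 * entry y 1.
Proof. by rewrite /dotp big_ord_recl big_ord1 !coords. Qed.

Definition linear_relation n (T : 'cV[k]_n -> k -> Prop) : Prop :=
  T 0 0 /\
  forall c y1 c1 y2 c2, T y1 c1 -> T y2 c2 -> T (c *: y1 + y2) (c * c1 + c2).

(** A single-valued linear relation to the scalars is a functional on a subspace;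
    it extends to the whole space, one coordinate at a time.  Whether the
    subspace contains a vector with first coordinate 1 is decided classically. *)
Lemma functional_extension n (T : 'cV[k]_n -> k -> Prop) :
  linear_relation T ->
  (forall c, T 0 c -> c = 0) ->
  exists w, forall y c, T y c -> dotp w y = c.
Proof.
elim: n T => [|n IHn] T [T0 Tlin] Tfun.
  exists 0 => y c; rewrite [y]flatmx0 => /Tfun ->; exact: dotp0.
pose ext (a : k) (y : 'cV[k]_n) : 'cV[k]_(1 + n) := col_mx a%:M y.
have extE c a1 y1 a2 y2 : c *: ext a1 y1 + ext a2 y2 = ext (c * a1 + a2) (c *: y1 + y2).
  by rewrite /ext scale_col_mx add_col_mx scale_scalar_mx -raddfD.
have ext0 : ext 0 0 = 0 by rewrite /ext raddf0 col_mx0.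
have extP (y : 'cV[k]_(1 + n)) : exists a z, y = ext a z.
  exists (y 0 0), (dsubmx y); rewrite /ext -[LHS]vsubmxK; congr col_mx.
  by rewrite [LHS]mx11_scalar mxE; congr (_ %:M); congr (y _ _); apply: val_inj.
(* The restriction to vectors with first coordinate 0 is extended first. *)
have [|c|w Hw] := IHn (fun y c => T (ext 0 y) c).
- split=> [|c y1 c1 y2 c2 T1 T2]; first by rewrite ext0.
  by have := Tlin c _ _ _ _ T1 T2; rewrite extE mulr0 addr0.
- by rewrite ext0; apply: Tfun.
have dotp_ext a b y : dotp (ext a w) (ext b y) = a * b + dotp w y.
  by rewrite dotp_split !col_mxKu !col_mxKd /dotp big_ord1 !mxE !mulr1n.
case: (classic (exists y c, T (ext 1 y) c)) => [[y0 [c0 T1]]|noT].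
  (* The first coefficient makes the functional equal to c0 at (1, y0). *)
  exists (ext (c0 - dotp w y0) w) => y c; have [a [z ->]] := extP y => Tz.
  have := Tlin (- a) _ _ _ _ T1 Tz; rewrite extE mulr1 addNr => /Hw.
  by rewrite dotp_linear dotp_ext => e; rewrite -[c](addKr (- a * c0)) addrC -e; ring.
exists (ext 0 w) => y c; have [a [z ->]] := extP y => Tz.
have a0 : a = 0.
  apply/eqP/negPn/negP => a0; apply: noT; exists (a^-1 *: z), (a^-1 * c).
  by have := Tlin a^-1 _ _ _ _ Tz T0; rewrite -ext0 extE mulVf // !addr0.
by rewrite a0 in Tz *; rewrite dotp_ext mul0r add0r; apply: Hw.
Qed.

(** Two partial functionals that agree on the intersection of their domains have a
    common extension: their sum is single-valued on the sum of the domains. *)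
Lemma common_extension n (R S : 'cV[k]_n -> k -> Prop) :
  linear_relation R -> linear_relation S ->
  (forall z c d, R z c -> S z d -> c = d) ->
  exists w, (forall z c, R z c -> dotp w z = c) /\ (forall z c, S z c -> dotp w z = c).
Proof.
move=> [R0 Rlin] [S0 Slin] RS.
pose T z c := exists z1 c1 z2 c2 : _,
  [/\ z = z1 + z2 :> 'cV[k]_n, c = c1 + c2, R z1 c1 & S z2 c2].
have [|c|w Tw] := @functional_extension n T.
- split=> [|c]; first by exists 0, 0, 0, 0; rewrite !addr0.
  move=> _ _ _ _ [z1 [c1 [z2 [c2 [-> -> Rz1 Sz2]]]]] [z3 [c3 [z4 [c4 [-> -> Rz3 Sz4]]]]].
  exists (c *: z1 + z3), (c * c1 + c3), (c *: z2 + z4), (c * c2 + c4).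
  by split; [rewrite scalerDr addrACA|rewrite mulrDr addrACA|exact: Rlin|exact: Slin].
- move=> [z1 [c1 [z2 [c2 [/esym/eqP + -> Rz1 Sz2]]]]]; rewrite addr_eq0 => /eqP e1.
  have := Slin (-1) _ _ _ _ Sz2 S0; rewrite !addr0 scaleN1r mulN1r -e1.
  by move=> /(RS _ _ _ Rz1) ->; rewrite addNr.
exists w; split=> z c zc; apply: Tw; first by exists z, c, 0, 0; rewrite !addr0.
by exists 0, 0, z, c; rewrite !add0r.
Qed.

End Functionals.

(** * The black box of the star dual is the annihilator *)

Section Annihilator.
Variables (k : fieldType) (L : eqType).
Implicit Types u v : L -> k.

Definition pairing (s : seq L) u v : k := \sum_(i <- s) u i * v i.

Lemma pairing_nil u v : pairing [::] u v = 0.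
Proof. exact: big_nil. Qed.

Lemma pairing_cat s t u v : pairing (s ++ t) u v = pairing s u v + pairing t u v.
Proof. exact: big_cat. Qed.

Lemma pairing0 s u : pairing s u (fun=> 0) = 0.
Proof. by rewrite /pairing big1 // => i _; rewrite mulr0. Qed.

Lemma pairing_linear s u c v1 v2 :
  pairing s u (fun i => c * v1 i + v2 i) = c * pairing s u v1 + pairing s u v2.
Proof.
rewrite /pairing mulr_sumr -big_split; apply: eq_bigr => i _.
by rewrite mulrDr mulrCA.
Qed.

Lemma pairing_glueL s u v1 v2 : pairing s u (glue s v1 v2) = pairing s u v1.
Proof. by apply: eq_big_seq => i /glueL ->. Qed.

Lemma pairing_glueR s t u v1 v2 : uniq (s ++ t) ->
  pairing t u (glue s v1 v2) = pairing t u v2.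
Proof. by move=> ust; apply: eq_big_seq => i /(glueR _ _ ust) ->. Qed.

Lemma interp_glueL s u1 u2 v1 v2 m n (f : diag k L m n) : {subset ints f <= s} ->
  eq_rel (interp (port (glue s u1 u2) (glue s v1 v2)) f) (interp (port u1 v1) f).
Proof. by move=> fs; apply: interp_ext => l /fs ls a b; rewrite /port !glueL. Qed.

Lemma interp_glueR s u1 u2 v1 v2 m n (f : diag k L m n) : uniq (s ++ ints f) ->
  eq_rel (interp (port (glue s u1 u2) (glue s v1 v2)) f) (interp (port u2 v2) f).
Proof.
by move=> uf; apply: interp_ext => l lf a b; rewrite /port !(glueR _ _ uf lf).
Qed.

(** The annihilator of the black box of [f] for the pairing of dual boundary and
    wire values, with a sign between inputs and outputs.  The values [u] leaving
    the integrators count as inputs and the values [v] entering them as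
    outputs.  For the graph of a matrix this is the graph of its transpose. *)
Definition annihilates m n (f : diag k L m n) u' v' (x' : 'cV[k]_m) (y' : 'cV[k]_n) :=
  forall u v x y, interp (port u v) f x y ->
  dotp x' x + pairing (ints f) u' u = dotp y' y + pairing (ints f) v' v.

Lemma dotp_cV0 (x y : 'cV[k]_0) : dotp x y = 0.
Proof. exact: big_ord0. Qed.

Lemma pairing_seq1 l u v : pairing [:: l] u v = u l * v l.
Proof. exact: big_seq1. Qed.

(** The constraints on a dual pair are extracted by testing it against a few
    vectors that span the black box of the generator. *)
Lemma interp_star_gen m n (g : gen k L m n) u' v' x' y' :
  interp (port v' u') (star_gen g) y' x' <-> annihilates (Gen g) u' v' x' y'.
Proof.
pose z : L -> k := fun=> 0.
have simp := (pairing_nil, pairing_seq1, dotp_cV0, dotp1, dotp2, addr0, add0r).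
case: g x' y' => [||||||c|l] x' y'; split=> [|ann].
- rewrite /=; coords => -[e0 e1] u v x y; rewrite /= !simp; coords => ->.
  by rewrite e0 e1 mulrDr.
- have e a b := ann z z (cvec 2 [:: a; b]) (cvec 1 [:: a + b]).
  have := e 0 1; have := e 1 0; rewrite /= !simp; coords.
  by rewrite !mulr0 !mulr1 !addr0 !add0r => -> // ->.
- by move=> _ u v x y; rewrite /= !simp; coords => ->; rewrite mulr0.
- by [].
- rewrite /=; coords => e u v x y; rewrite /= !simp; coords => -[-> ->].
  by rewrite e mulrDl.
- have := ann z z (cvec 1 [:: 1]) (cvec 2 [:: 1; 1]).
  by rewrite /= !simp; coords; rewrite !mulr1; apply.
- by rewrite /=; coords => e u v x y; rewrite /= !simp; coords; rewrite e mul0r.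
- have := ann z z (cvec 1 [:: 1]) 0; rewrite /= !simp; coords.
  by rewrite mulr1; apply.
- move=> [w [+ [/eq_cV1 + +]]]; rewrite /=; coords => e0 e1 e2 u v x y.
  rewrite /= !simp; coords.
  by move=> ->; rewrite e2 e1 e0 mulN1r mulNr addrN.
- have := ann z z (cvec 2 [:: 1; 1]) 0; rewrite /= !simp; coords.
  rewrite !mulr1 => /(_ erefl)/eqP; rewrite addrC addr_eq0 => /eqP e.
  exists (cvec 2 [:: x' 0 0; x' 0 0]); coords_split.
  by rewrite e mulN1r.
- move=> [w [[/eq_cV1 + +] +]]; rewrite /=; coords => e0 e1 e2 u v x y.
  rewrite /= !simp; coords.
  by move=> ->; rewrite -e0 e2 e1 mulN1r mulNr addNr.
- have := ann z z 0 (cvec 2 [:: 1; 1]); rewrite /= !simp; coords.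
  rewrite !mulr1 => /(_ erefl)/esym/eqP; rewrite addr_eq0 => /eqP e.
  exists (cvec 2 [:: y' 0 0; y' 0 0]); coords_split.
  by rewrite e mulN1r.
- rewrite /=; coords => e u v x y; rewrite /= !simp; coords => ->.
  by rewrite e mulrCA mulrA.
- have := ann z z (cvec 1 [:: 1]) (cvec 1 [:: c]); rewrite /= !simp; coords.
  by rewrite !mulr1 mulrC; apply.
- rewrite /= /port; coords => -[e1 e2] u v x y; rewrite /= !simp; coords => -[-> ->].
  by rewrite -e1 -e2 addrC.
- have e a b := ann (fun=> b) (fun=> a) (cvec 1 [:: a]) (cvec 1 [:: b]).
  have := e 0 1; have := e 1 0; rewrite /= /port !simp; coords.
  rewrite !mulr0 !mulr1 !addr0 !add0r => -> // -> //.
Qed.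

(** Color swap realizes orthogonality: on generators this is a computation.  For
    a composite, a pair in the annihilator must be factored through an
    intermediate dual vector [z'].  The constraint says that the functional
    which the inner diagram forces on the middle wires and the one which the
    outer diagram forces on them agree where both are defined, so [z'] is a
    common extension of the two.  Labels must be distinct for the wire values of
    the two parts to be chosen independently. *)
Lemma interp_star m n (f : diag k L m n) u' v' x' y' : uniq (ints f) ->
  interp (port v' u') (star f) y' x' <-> annihilates f u' v' x' y'.
Proof.
elim: f x' y' => {m n} [m|m n|m n g|m n p g IHg f IHf|m n p q g IHg f IHf] x' y' uf.
- split=> [-> u v x y ->|ann] /=; first by rewrite !pairing_nil.
  apply: dotp_inj => z; have := ann (fun=> 0) (fun=> 0) z z erefl.
  by rewrite !pairing_nil !addr0.
- split=> [-> u v x y ->|ann] /=.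
    rewrite !pairing_nil !addr0 !dotp_split !col_mxKu !col_mxKd; exact: addrC.
  apply: dotp_inj => z; have := ann (fun=> 0) (fun=> 0) z _ erefl.
  rewrite !pairing_nil !addr0 !dotp_split !col_mxKu !col_mxKd => ->; exact: addrC.
- exact: interp_star_gen.
- move: uf => /= ufg; move: (ufg); rewrite cat_uniq => /and3P[Ug _ Uf].
  split.
    move=> [z' [/(IHg _ _ Ug) gz /(IHf _ _ Uf) fz]] u v x y [z [/fz ef /gz eg]].
    by rewrite !pairing_cat addrCA ef addrCA addrA eg -addrA.
  move=> ann.
  (* The constraint, with independent wire values for the two parts. *)
  have comp_ann ug vg uh vh x z y : interp (port ug vg) g z y ->
      interp (port uh vh) f x z ->
      dotp x' x + (pairing (ints g) u' ug + pairing (ints f) u' uh) =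
      dotp y' y + (pairing (ints g) v' vg + pairing (ints f) v' vh).
    move=> gzy fxz.
    have := ann (glue (ints g) ug uh) (glue (ints g) vg vh) x y.
    rewrite !pairing_cat !pairing_glueL !(pairing_glueR _ _ _ ufg).
    by apply; exists z; split; [exact/interp_glueR|exact/interp_glueL].
  (* The functionals forced on the middle wires by f and by g. *)
  have [||z c d|z' [Rz' Sz']] := @common_extension _ _
    (fun z c => exists u v x, interp (port u v) f x z /\
       c = dotp x' x + pairing (ints f) u' u - pairing (ints f) v' v)
    (fun z c => exists u v y, interp (port u v) g z y /\
       c = dotp y' y + pairing (ints g) v' v - pairing (ints g) u' u).
  + split.
      exists (fun=> 0), (fun=> 0), 0; split; first exact: interp_port0.
      by rewrite !pairing0 dotp0 subr0 addr0.
    move=> c z1 _ z2 _ [u1 [v1 [x1 [f1 ->]]]] [u2 [v2 [x2 [f2 ->]]]].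
    do 3 eexists; split; first exact: (interp_port_linear c f1 f2).
    by rewrite dotp_linear !pairing_linear; ring.
  + split.
      exists (fun=> 0), (fun=> 0), 0; split; first exact: interp_port0.
      by rewrite !pairing0 dotp0 subr0 addr0.
    move=> c z1 _ z2 _ [u1 [v1 [x1 [f1 ->]]]] [u2 [v2 [x2 [f2 ->]]]].
    do 3 eexists; split; first exact: (interp_port_linear c f1 f2).
    by rewrite dotp_linear !pairing_linear; ring.
  + move=> [uh [vh [x [fxz ->]]]] [ug [vg [y [gzy ->]]]].
    have e := comp_ann _ _ _ _ _ _ _ gzy fxz.
    transitivity (dotp x' x + (pairing (ints g) u' ug + pairing (ints f) u' uh)
                  - pairing (ints g) u' ug - pairing (ints f) v' vh); first by ring.
    by rewrite e; ring.
  exists z'; split; [apply/IHg|apply/IHf] => // u v a b ab.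
    have -> : dotp z' a = dotp y' b + pairing (ints g) v' v - pairing (ints g) u' u.
      by apply: Sz'; exists u, v, b.
    by ring.
  have -> : dotp z' b = dotp x' a + pairing (ints f) u' u - pairing (ints f) v' v.
    by apply: Rz'; exists u, v, a.
  by ring.
- move: uf => /= ufg; move: (ufg); rewrite cat_uniq => /and3P[Ug _ Uf].
  rewrite (IHg _ _ Ug) (IHf _ _ Uf); split.
    move=> [eg ef] u v x y [/eg {}eg /ef {}ef].
    by rewrite !pairing_cat !dotp_split addrACA eg ef addrACA.
  have tens_ann ug vg xg yg uh vh xf yf : annihilates (g + f)%D u' v' x' y' ->
      interp (port ug vg) g xg yg -> interp (port uh vh) f xf yf ->
      dotp (usubmx x') xg + dotp (dsubmx x') xf +
        (pairing (ints g) u' ug + pairing (ints f) u' uh) =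
      dotp (usubmx y') yg + dotp (dsubmx y') yf +
        (pairing (ints g) v' vg + pairing (ints f) v' vh).
    move=> ann gxy fxy.
    have := ann (glue (ints g) ug uh) (glue (ints g) vg vh) (col_mx xg xf) (col_mx yg yf).
    rewrite !pairing_cat !pairing_glueL !(pairing_glueR _ _ _ ufg) !dotp_split.
    rewrite /= !col_mxKu !col_mxKd; apply.
    by split; [exact/interp_glueL|exact/interp_glueR].
  move=> ann; split=> u v x y xy.
    have := tens_ann _ _ _ _ _ _ _ _ ann xy (interp_port0 f).
    by rewrite !pairing0 !dotp0 !addr0.
  have := tens_ann _ _ _ _ _ _ _ _ ann (interp_port0 g) xy.
  by rewrite !pairing0 !dotp0 !add0r.
Qed.

End Annihilator.

(** * State-space matrices *)

Section StateSpaceTheory.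
Variable k : fieldType.

Lemma interp_zeros L (I : L -> k -> k -> Prop) m x y :
  interp I (zeros k L m) x y <-> y = 0.
Proof.
elim: m x y => [|m IHm] x y.
  by split=> _; [exact: flatmx0|rewrite /= [x]flatmx0 [y]flatmx0].
rewrite /= IHm (@eq_col2 _ 1 m y) !linear0; split=> -[e ->]; split=> //.
  by apply/colP=> i; rewrite ord1 e mxE.
by rewrite e mxE.
Qed.

Lemma interp_dels L (I : L -> k -> k -> Prop) p x y : interp I (dels k L p) x y.
Proof. by elim: p x y => [|p IHp] x y /=; rewrite ?[y]flatmx0 ?[x]flatmx0. Qed.

Definition opened n m p (f : diag k 'I_n m p) (u : 'cV_n) x (v : 'cV_n) y : Prop :=
  interp (port (u^~ 0) (v^~ 0)) f x y.

Lemma opened_ext n m p (f : diag k 'I_n m p) (u0 v0 : 'I_n -> k) (u v : 'cV_n) x y :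
  (forall i, u i 0 = u0 i) -> (forall i, v i 0 = v0 i) ->
  interp (port u0 v0) f x y <-> opened f u x v y.
Proof. by move=> eu ev; apply: interp_ext => l _ a b; rewrite /port eu ev. Qed.

Lemma opened_linear n m p (f : diag k 'I_n m p) c u1 x1 v1 y1 u2 x2 v2 y2 :
  opened f u1 x1 v1 y1 -> opened f u2 x2 v2 y2 ->
  opened f (c *: u1 + u2) (c *: x1 + x2) (c *: v1 + v2) (c *: y1 + y2).
Proof.
move=> f1 f2; apply: (proj1 (opened_ext _ _ _ _ _)) (interp_port_linear c f1 f2) => i;
  by rewrite !mxE.
Qed.

Lemma relA_opened n m p (f : diag k 'I_n m p) u v :
  relA f u v <-> exists y, opened f u 0 v y.
Proof.
split=> [[y [[x [/interp_zeros -> fy]] _]]|[y fy]]; first by exists y.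
exists y; split; last exact: interp_dels.
by exists 0; split; first exact/interp_zeros.
Qed.

Lemma relB_opened n m p (f : diag k 'I_n m p) x v :
  relB f x v <-> exists y, opened f 0 x v y.
Proof.
have e y : interp (fun i a b => a = v i 0 /\ b = 0) f x y <-> opened f 0 x v y.
  by apply: opened_ext => // i; rewrite mxE.
split=> [[y [/e fy _]]|[y /e fy]]; exists y => //.
by split=> //; apply: interp_dels.
Qed.

Lemma opened_choose n m p (f : diag k 'I_n m p) (R : 'I_n -> k -> k -> Prop)
    (u : 'cV_n) x y :
  uniq (ints f) -> (forall i a b, R i a b <-> b = u i 0) ->
  interp R f x y <-> exists v, opened f u x v y.
Proof.
move=> uf RE.
have -> : interp R f x y <-> interp (fun i a b => exists c, a = c /\ b = u i 0) f x y.
  by apply: interp_ext => i _ a b; rewrite RE; split=> [|[c []]] //; exists a.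
rewrite (interp_choose 0 (fun i c a b => a = c /\ b = u i 0) x y uf).
split=> [[w fw]|[v fv]]; last by exists (v^~ 0).
by exists (\col_i w i); apply: (proj1 (opened_ext _ _ _ _ _)) fw => i; rewrite ?mxE.
Qed.

Lemma relC_opened n m p (f : diag k 'I_n m p) u y : uniq (ints f) ->
  relC f u y <-> exists v, opened f u 0 v y.
Proof.
move=> uf; rewrite -(@opened_choose _ _ _ _ (fun i _ b => b = u i 0)) //.
split=> [[x [/interp_zeros -> fy]]|fy] //.
by exists 0; split; first exact/interp_zeros.
Qed.

Lemma relD_opened n m p (f : diag k 'I_n m p) x y : uniq (ints f) ->
  relD f x y <-> exists v, opened f 0 x v y.
Proof.
move=> uf; rewrite -(@opened_choose _ _ _ _ (fun _ a b => b = 0 * a)) //.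
  exact: interp_subst.
by move=> i a b; rewrite mul0r mxE.
Qed.

(** The equations of a linear system: [u] is the state and [v] its derivative. *)
Definition state_space n m p (f : diag k 'I_n m p)
    (A : 'M_n) (B : 'M_(n, m)) (C : 'M_(p, n)) (D : 'M_(p, m)) : Prop :=
  forall u x v y,
    opened f u x v y <-> v = A *m u + B *m x /\ y = C *m u + D *m x.

(** The four relations are restrictions of the opened black box.  That they are
    linear maps forces the opened black box to be a linear map: A and C make it
    single-valued at 0, hence everywhere, and superposing the solutions for
    (u, 0) and (0, x) makes it total. *)
Lemma state_spaceP n m p (f : diag k 'I_n m p) A B C D : uniq (ints f) ->
  state_space f A B C D <->
  [/\ eq_rel (relA f) (graph A), eq_rel (relB f) (graph B),
      eq_rel (relC f) (graph C) & eq_rel (relD f) (graph D)].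
Proof.
move=> uf; split=> [fP|[fA fB fC fD] u x v y].
  split=> a b; rewrite ?relA_opened ?relB_opened ?relC_opened ?relD_opened //.
  - split=> [[c /fP[-> _]]|->]; first by rewrite mulmx0 addr0.
    by eexists; apply/fP; rewrite !mulmx0 !addr0.
  - split=> [[c /fP[-> _]]|->]; first by rewrite mulmx0 add0r.
    by eexists; apply/fP; rewrite !mulmx0 !add0r.
  - split=> [[c /fP[_ ->]]|->]; first by rewrite mulmx0 addr0.
    by eexists; apply/fP; rewrite !mulmx0 !addr0.
  - split=> [[c /fP[_ ->]]|->]; first by rewrite mulmx0 add0r.
    by eexists; apply/fP; rewrite !mulmx0 !add0r.
have f0 v0 y0 : opened f 0 0 v0 y0 -> v0 = 0 /\ y0 = 0.
  move=> fvy; split.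
    by rewrite (proj1 (fA 0 v0)) ?mulmx0 //; apply/relA_opened; exists y0.
  by rewrite (proj1 (fC 0 y0)) ?mulmx0 //; apply/relC_opened => //; exists v0.
have fAC : opened f u 0 (A *m u) (C *m u).
  have /relA_opened[y1 f1] : relA f u (A *m u) by apply/fA.
  by rewrite -(proj1 (fC u y1)) //; apply/relC_opened => //; exists (A *m u).
have fBD : opened f 0 x (B *m x) (D *m x).
  have /relB_opened[y1 f1] : relB f x (B *m x) by apply/fB.
  by rewrite -(proj1 (fD x y1)) //; apply/relD_opened => //; exists (B *m x).
have := opened_linear 1 fAC fBD; rewrite !scale1r addr0 add0r => fux.
split=> [fuv|[-> ->]] //.
have := opened_linear (-1) fux fuv; rewrite !scaleN1r !addNr => /f0[/eqP + /eqP].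
by rewrite ![- _ + _]addrC !subr_eq0 => /eqP -> /eqP ->.
Qed.

(** The annihilator of the graph of the block matrix with rows (A, B) and (C, D)
    is the graph of its transpose, whose off-diagonal blocks are C^T and B^T. *)
Lemma state_space_star n m p (f : diag k 'I_n m p) A B C D :
  perm_eq (ints f) (enum 'I_n) -> state_space f A B C D ->
  state_space (star f) A^T C^T B^T D^T.
Proof.
move=> pf fP v' y' u' x'.
have uf : uniq (ints f) by rewrite (perm_uniq pf) enum_uniq.
have pairE (a b : 'cV[k]_n) : pairing (ints f) (a^~ 0) (b^~ 0) = dotp a b.
  rewrite /pairing (perm_big _ pf) big_enum /=; exact: eq_bigl.
have dotpDl q (a b c : 'cV[k]_q) : dotp (a + b) c = dotp a c + dotp b c.
  by rewrite /dotp -big_split; apply: eq_bigr => i _; rewrite mxE mulrDl.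
have dotpDr q (a b c : 'cV[k]_q) : dotp a (b + c) = dotp a b + dotp a c.
  by rewrite -{1}[b]scale1r dotp_linear mul1r.
rewrite /opened (interp_star _ _ _ _ uf); split=> [ann|[-> ->] u v x y fuv].
  have {}ann u x : dotp x' x + dotp u' u =
      dotp (C^T *m y' + A^T *m v') u + dotp (D^T *m y' + B^T *m v') x.
    have := ann _ _ _ _ (proj2 (fP u x _ _) (conj erefl erefl)).
    by rewrite !pairE !dotpDr !dotp_mul !dotpDl => ->; ring.
  split; apply: dotp_inj => z.
    by have := ann z 0; rewrite !dotp0 add0r addr0 addrC => ->; rewrite addrC.
  by have := ann 0 z; rewrite !dotp0 add0r addr0 addrC => ->; rewrite addrC.
have /fP[ev ey] : opened f (\col_i u i) x (\col_i v i) y.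
  by apply: (proj1 (opened_ext _ _ _ _ _)) fuv => i; rewrite mxE.
have pairE' (a : 'cV[k]_n) b : pairing (ints f) (a^~ 0) b = dotp a (\col_i b i).
  by rewrite -pairE; apply: eq_bigr => i _; rewrite mxE.
by rewrite !pairE' ev ey !dotpDr !dotp_mul !dotpDl; ring.
Qed.

Lemma perm_of_seqs (T : finType) (s t : seq T) :
  uniq s -> uniq t -> size s = size t -> (forall i, i \in s) ->
  exists sigma : {perm T}, map sigma s = t.
Proof.
case: s => [|i0 s'] us ut est sT; first by case: t est {ut} => // _; exists 1%g.
set s := i0 :: s' in us est sT; pose phi i := nth i0 t (index i s).
have lt_t i : (index i s < size t)%N by rewrite -est index_mem.
have phi_inj : injective phi.
  move=> i j /eqP; rewrite nth_uniq // => /eqP e.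
  by rewrite -(nth_index i0 (sT i)) e nth_index.
exists (perm phi_inj); apply: (@eq_from_nth _ i0); rewrite size_map // => i lt_i.
by rewrite (nth_map i0) // permE /phi index_uniq.
Qed.

Lemma ints_numbering n m p (f' : diag k 'I_n m p) (f : SigFlow k m p) :
  numbering f' f -> size (ints f) = n.
Proof.
case=> pf /size_ints_deq <-.
by rewrite [forget f']/(relabel _ _) ints_relabel size_map (perm_size pf) size_enum_ord.
Qed.

(** Two numberings of one morphism differ by a permutation of the states, which
    conjugates A and acts on one side of B and of C. *)
Lemma state_space_numbering n1 n2 m p (f1 : diag k 'I_n1 m p) (f2 : diag k 'I_n2 m p)
    (f : SigFlow k m p) A B C D :
  numbering f1 f -> numbering f2 f -> state_space f1 A B C D ->
  exists A' B' C' D', state_space f2 A' B' C' D'.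
Proof.
move=> nf1 nf2; have en := ints_numbering nf1; rewrite (ints_numbering nf2) in en.
case: n1 / en in f1 nf1 A B C *; case: nf1 nf2 => [p1 d1] [p2 d2] fP.
have [lift _] := lift_deq (deq_trans d1 (deq_sym d2)).
have es : size (ints f1) = size (ints (forget f1)).
  by rewrite [forget f1]/(relabel _ _) ints_relabel size_map.
have [s ps] := lift _ _ es; rewrite label_forget => d12.
have ps' := perm_trans ps p1.
have [||||sigma es2] := @perm_of_seqs _ s (ints f2).
- by rewrite (perm_uniq ps') enum_uniq.
- by rewrite (perm_uniq p2) enum_uniq.
- by rewrite (perm_size ps') (perm_size p2).
- by move=> i; rewrite (perm_mem ps') mem_enum.
pose P := perm_mx sigma : 'M[k]_n2.
have PV : perm_mx sigma^-1 *m P = 1%:M by rewrite -perm_mxM mulVg perm_mx1.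
have VP : P *m perm_mx sigma^-1 = 1%:M by rewrite -perm_mxM mulgV perm_mx1.
have f12 u x v y : opened f2 u x v y <-> opened f1 (P *m u) x (P *m v) y.
  rewrite /opened -[f2]label_forget -es2 label_map.
  rewrite (interp_relabel _ _ _ x y) (interp_deq _ d12 x y).
  by apply: opened_ext => i; rewrite -row_permE mxE.
exists (perm_mx sigma^-1 *m A *m P), (perm_mx sigma^-1 *m B), (C *m P), D.
move=> u x v y; rewrite f12 fP -!mulmxA -mulmxDr.
split=> -[ev ->]; split=> //; first by rewrite -ev mulmxA PV mul1mx.
by rewrite ev mulmxA VP mul1mx.
Qed.

Lemma ContFlowP m p (f : SigFlow k m p) :
  ContFlow f <-> exists n (f' : diag k 'I_n m p), numbering f' f /\
    exists A B C D, state_space f' A B C D.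
Proof.
split=> -[n [f' [nf]]].
  have uf : uniq (ints f') by rewrite (perm_uniq (proj1 nf)) enum_uniq.
  move=> [[A fA] [B fB] [C fC] [D fD]]; exists n, f'; split=> //.
  by exists A, B, C, D; apply/state_spaceP.
have uf : uniq (ints f') by rewrite (perm_uniq (proj1 nf)) enum_uniq.
move=> [A [B [C [D /state_spaceP-/(_ uf)[fA fB fC fD]]]]]; exists n, f'; split=> //.
by split; [exists A|exists B|exists C|exists D].
Qed.

(** Membership is witnessed by some numbering, and therefore by every one. *)
Lemma ContFlow_numbering n m p (f : SigFlow k m p) (f' : diag k 'I_n m p) :
  ContFlow f -> numbering f' f -> exists A B C D, state_space f' A B C D.
Proof.
move=> /ContFlowP[n1 [f1 [nf1 [A [B [C [D fP]]]]]]] nf.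
exact: state_space_numbering nf1 nf fP.
Qed.

Lemma transpose_graph m n (R : rel_vec k m n) M :
  eq_rel R (graph M) -> eq_rel (transpose_rel R) (graph M^T).
Proof.
move=> RM y x; split=> [[N [RN ->]]|->]; last by exists M.
suff -> : N = M by [].
apply/matrixP=> i j; have /RN : R (delta_mx j 0) (M *m delta_mx j 0) by apply/RM.
by rewrite /graph -!colE => /colP/(_ i); rewrite !mxE.
Qed.

(** * Closure properties *)

Lemma perm_ints0 : perm_eq (Nil 'I_0) (enum 'I_0).
Proof. by rewrite (size0nil (size_enum_ord 0)). Qed.

Lemma ContFlow_Id m : ContFlow (Id m : SigFlow k m m).
Proof.
apply/ContFlowP; exists 0%N, (Id m); split; first by split; [exact: perm_ints0|exact: deq_refl].
exists 0, 0, 0, 1%:M => u x v y.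
by rewrite !(mul0mx, mul1mx, add0r) [v]flatmx0; split=> [->|[]].
Qed.

Lemma ContFlow_Zero : ContFlow (Gen Zero : SigFlow k 0 1).
Proof.
apply/ContFlowP; exists 0%N, (Gen Zero); split; first by split; [exact: perm_ints0|exact: deq_refl].
exists 0, 0, 0, 0 => u x v y.
rewrite !(mul0mx, add0r) [v]flatmx0 /opened /=; split=> [e|[_ ->]]; last by rewrite mxE.
by split=> //; apply/colP=> i; rewrite ord1 e mxE.
Qed.

(** Series connection: the output of the first system is the input of the second. *)
Lemma state_space_comp n1 n2 m q p (f : diag k 'I_n1 m q) (g : diag k 'I_n2 q p)
    A1 B1 C1 D1 A2 B2 C2 D2 :
  state_space f A1 B1 C1 D1 -> state_space g A2 B2 C2 D2 ->
  state_space (relabel (@rshift n1 n2) g \o relabel (@lshift n1 n2) f)%D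
    (block_mx A1 0 (B2 *m C1) A2) (col_mx B1 (B2 *m D1))
    (row_mx (D2 *m C1) C2) (D2 *m D1).
Proof.
move=> fP gP u x v y; rewrite -[u]vsubmxK -[v]vsubmxK.
move: (usubmx u) (dsubmx u) (usubmx v) (dsubmx v) => {u v} u1 u2 v1 v2.
pose u := col_mx u1 u2; pose v := col_mx v1 v2.
have -> : opened (relabel (@rshift n1 n2) g \o relabel (@lshift n1 n2) f)%D u x v y <->
    exists z, opened f u1 x v1 z /\ opened g u2 z v2 y.
  have fE z : opened f u1 x v1 z <->
      interp (port (u^~ 0) (v^~ 0)) (relabel (@lshift n1 n2) f) x z.
    rewrite (interp_relabel _ _ _ x z); symmetry.
    by apply: opened_ext => i; rewrite col_mxEu.
  have gE z : opened g u2 z v2 y <->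
      interp (port (u^~ 0) (v^~ 0)) (relabel (@rshift n1 n2) g) z y.
    rewrite (interp_relabel _ _ _ z y); symmetry.
    by apply: opened_ext => i; rewrite col_mxEd.
  by split=> -[z [/fE ? /gE ?]]; exists z.
rewrite mul_block_col mul_col_mx add_col_mx eq_col2 !col_mxKu !col_mxKd.
rewrite mul_row_col mul0mx addr0.
have sum_comp a (M : 'M[k]_(a, q)) (N : 'M_(a, n2)) :
    N *m u2 + M *m (C1 *m u1 + D1 *m x) = M *m C1 *m u1 + N *m u2 + M *m D1 *m x.
  by rewrite mulmxDr !mulmxA addrCA addrA.
rewrite -!sum_comp; split=> [[z [/fP[-> ->] /gP[-> ->]]]|[[ev1 ev2] ey]] //.
by exists (C1 *m u1 + D1 *m x); split; [apply/fP|apply/gP].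
Qed.

Lemma numbering_comp n1 n2 m q p (f' : diag k 'I_n1 m q) (g' : diag k 'I_n2 q p)
   (f : SigFlow k m q) (g : SigFlow k q p) :
  numbering f' f -> numbering g' g ->
  numbering (relabel (@rshift n1 n2) g' \o relabel (@lshift n1 n2) f')%D (g \o f)%D.
Proof.
move=> [pf df] [pg dg]; split; last first.
  have -> : forget (relabel (@rshift n1 n2) g' \o relabel (@lshift n1 n2) f')%D =
      (forget g' \o forget f')%D.
    by rewrite -(forget_relabel (@rshift n1 n2) g') -(forget_relabel (@lshift n1 n2) f').
  exact: deq_comp.
rewrite /= !ints_relabel; apply: uniq_perm; rewrite ?enum_uniq //.
  rewrite cat_uniq !map_inj_uniq ?(perm_uniq pf) ?(perm_uniq pg) ?enum_uniq //=;
    [|exact: lshift_inj|exact: rshift_inj].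
  rewrite andbT; apply/hasPn => _ /mapP[i _ ->]; apply/negP => /mapP[j _ /eqP].
  by rewrite eq_lrshift.
move=> i; rewrite mem_enum mem_cat inE; apply/orP.
case: (split_ordP i) => j ->; [right|left]; apply: map_f.
  by rewrite (perm_mem pf) mem_enum.
by rewrite (perm_mem pg) mem_enum.
Qed.

Lemma ContFlow_comp m q p (g : SigFlow k q p) (f : SigFlow k m q) :
  ContFlow g -> ContFlow f -> ContFlow (g \o f)%D.
Proof.
move=> /ContFlowP[n2 [g' [ng [A2 [B2 [C2 [D2 gP]]]]]]].
move=> /ContFlowP[n1 [f' [nf [A1 [B1 [C1 [D1 fP]]]]]]].
apply/ContFlowP; do 2 eexists; split; first exact: numbering_comp nf ng.
by do 4 eexists; apply: state_space_comp fP gP.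
Qed.

Lemma numbering_star n m p (f' : diag k 'I_n m p) (f : SigFlow k m p) :
  numbering f' f -> numbering (star f') (star f).
Proof.
have perm_star a b (h : diag k 'I_n a b) : perm_eq (ints (star h)) (ints h).
  elim: h => {a b} [a|a b|a b []|a b c g IHg h IHh|a b c d g IHg h IHh] //=.
    by rewrite perm_catC perm_cat.
  by rewrite perm_cat.
have forget_star a b (h : diag k 'I_n a b) : forget (star h) = star (forget h).
  rewrite /forget.
  elim: h => {a b} [a|a b|a b []|a b c g IHg h IHh|a b c d g IHg h IHh] //=;
    by rewrite IHg IHh.
move=> [pf df]; split; first exact: perm_trans (perm_star _ _ _) pf.
by rewrite forget_star; apply: star_deq.
Qed.

Lemma numbering_dagger n m p (f' : diag k 'I_n m p) (f : SigFlow k m p) :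
  numbering f' f -> numbering (dagger f') (dagger f).
Proof.
have perm_dagger a b (h : diag k 'I_n a b) : perm_eq (ints (dagger h)) (ints h).
  elim: h => {a b} [a|a b|a b []|a b c g IHg h IHh|a b c d g IHg h IHh] //=.
    by rewrite perm_catC perm_cat.
  by rewrite perm_cat.
have forget_dagger a b (h : diag k 'I_n a b) : forget (dagger h) = dagger (forget h).
  rewrite /forget.
  elim: h => {a b} [a|a b|a b []|a b c g IHg h IHh|a b c d g IHg h IHh] //=;
    by rewrite IHg IHh.
move=> [pf df]; split; first exact: perm_trans (perm_dagger _ _ _) pf.
by rewrite forget_dagger; apply: dagger_deq.
Qed.

Lemma numbering_exists m p (f : SigFlow k m p) :
  exists n (f' : diag k 'I_n m p), numbering f' f.
Proof.
have es : size (enum 'I_(size (ints f))) = size (ints f) by rewrite size_enum_ord.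
exists (size (ints f)), (label f (enum 'I_(size (ints f)))); split.
  by rewrite ints_label.
by rewrite forget_label // forget_id; apply: deq_refl.
Qed.

Lemma same_blackbox_star2 m p (f : SigFlow k m p) : same_blackbox (star (star f)) f.
Proof.
have [n [f' nf]] := numbering_exists f; exists n, (star (star f')), f'.
by split=> // [|u v x y]; [do 2 apply: numbering_star|apply: interp_star2].
Qed.

Lemma same_blackbox_dagger2 m p (f : SigFlow k m p) :
  same_blackbox (dagger (dagger f)) f.
Proof.
have [n [f' nf]] := numbering_exists f; exists n, (dagger (dagger f')), f'.
split=> // [|u v x y]; first by do 2 apply: numbering_dagger.
by rewrite !interp_dagger.
Qed.

(** The converse of the relation choosing 0 is the relation that accepts only 0,
    which is not total: the input 1 has no output. *)
Lemma dagger_Zero_not_ContFlow : ~ ContFlow (dagger (Gen Zero : SigFlow k 0 1)).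
Proof.
move=> [n [f' [[_ df] [_ _ _ [M fM]]]]].
have /fM : graph M (const_mx 1) 0 by rewrite /graph [RHS]flatmx0.
rewrite /relD /blackbox (interp_subst (J := fun _ a b => b = 0 * a)) //.
rewrite -(interp_subst (I := fun _ a b => b = 0 * a) (phi := fun=> Gen (Int tt))) //.
rewrite (interp_deq _ df) interp_dagger /= mxE => /eqP; exact/negP/oner_neq0.
Qed.

End StateSpaceTheory.

(** * The two dualities *)

Theorem mainTheorem6 (k : fieldType) :
  let star_k := fun (m p : nat) (f : SigFlow k m p) => star f in
  let dagger_k := fun (m p : nat) (f : SigFlow k m p) => dagger f in
  let All := fun (m p : nat) (f : SigFlow k m p) => True in
  (dagger_category All star_k /\ dagger_category All dagger_k) /\
  dagger_category (@ContFlow k) star_k /\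
  ~ dagger_category (@ContFlow k) dagger_k /\
  (forall (m p : nat) (f : SigFlow k m p), ContFlow f ->
     ContFlow (star f) /\
     forall (n : nat) (f' : diag k 'I_n m p), numbering f' f ->
       numbering (star f') (star f) /\
       eq_rel (relA (star f')) (transpose_rel (relA f')) /\
       eq_rel (relB (star f')) (transpose_rel (relC f')) /\
       eq_rel (relD (star f')) (transpose_rel (relD f')) /\
       eq_rel (relC (star f')) (transpose_rel (relB f'))).
Proof.
move=> star_k dagger_k All.
have dual m p (f : SigFlow k m p) : ContFlow f ->
    ContFlow (star f) /\
    forall (n : nat) (f' : diag k 'I_n m p), numbering f' f ->
      numbering (star f') (star f) /\
      eq_rel (relA (star f')) (transpose_rel (relA f')) /\
      eq_rel (relB (star f')) (transpose_rel (relC f')) /\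
      eq_rel (relD (star f')) (transpose_rel (relD f')) /\
      eq_rel (relC (star f')) (transpose_rel (relB f')).
  move=> cf; split.
    have [n [f' nf]] := numbering_exists f.
    have [A [B [C [D fP]]]] := ContFlow_numbering cf nf.
    apply/ContFlowP; exists n, (star f'); split; first exact: numbering_star.
    by do 4 eexists; apply: state_space_star fP; case: nf.
  move=> n f' nf; have nf' := numbering_star nf; split=> //.
  have [A [B [C [D fP]]]] := ContFlow_numbering cf nf.
  have uf : uniq (ints f') by rewrite (perm_uniq (proj1 nf)) enum_uniq.
  have uf' : uniq (ints (star f')) by rewrite (perm_uniq (proj1 nf')) enum_uniq.
  have fP' := state_space_star (proj1 nf) fP.
  have [fA fB fC fD] := proj1 (state_spaceP _ _ _ _ uf) fP.
  have [gA gB gC gD] := proj1 (state_spaceP _ _ _ _ uf') fP'.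
  have fin a b (R : rel_vec k a b) S (M : 'M[k]_(a, b)) :
      eq_rel R (graph M^T) -> eq_rel S (graph M) -> eq_rel R (transpose_rel S).
    by move=> RM SM x y; rewrite (RM x y) (transpose_graph SM x y).
  split; first exact: fin gA fA.
  split; first exact: fin gB fC.
  by split; [exact: fin gD fD|exact: fin gC fB].
split; last split; last split; last exact: dual.
- split; split=> // *; try exact: deq_refl.
  + exact: star_deq.
  + exact: same_blackbox_star2.
  + exact: dagger_deq.
  + exact: same_blackbox_dagger2.
- split.
  + move=> m p f g fg [n [f' [[pf df] lin]]].
    by exists n, f'; split; [split; [|exact: deq_trans df fg]|].
  + exact: ContFlow_Id.
  + exact: ContFlow_comp.
  + by move=> m p f /dual[].
  + by move=> m p f g _ _; apply: star_deq.
  + by move=> m; apply: deq_refl.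
  + by move=> *; apply: deq_refl.
  + by move=> *; apply: same_blackbox_star2.
- move=> [_ _ _ dual' _ _ _ _].
  exact: dagger_Zero_not_ContFlow (dual' _ _ _ (ContFlow_Zero k)).
Qed.
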